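(* Suppose $V$ satisfies Assumption 1 (stated in the context) with constants $M,L,m>0$, and let $f\in C^s$ for some $s=1+\rho$, $\rho\in(0,1]$. Let $\sigma_f(\theta):=\langle\mathcal{I}^{-1}f'(\theta),f'(\theta)\rangle^{1/2}$. Then, for all $c>0$ and all $\theta_0\in\mathbb{R}^d$, $$\inf_{\hat T_n}\sup_{\|\theta-\theta_0\|\le\frac{c}{\sqrt n}}\frac{\sqrt n\,\|\hat T_n-f(\theta)\|_{L_2(\mathbb{P}_\theta)}}{\sigma_f(\theta)}\ \ge\ 1-\frac{3\pi}{\sqrt{8m}\,c}-\frac{2}{\sqrt m}\,\frac{\|f\|_{C^s}}{\sigma_f(\theta_0)}\Bigl(\frac{c}{\sqrt n}\Bigr)^{\rho},$$ where the infimum is taken over all estimators $\hat T_n=\hat T_n(X_1,\dots,X_n)$.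
   Context: Model. Let $n,d\ge 1$ be integers and let $V:\mathbb{R}^d\to\mathbb{R}$ be a (known) convex function with $\int e^{-V(x)}dx=1$. Put $P(dx)=e^{-V(x)}dx$ and $P_\theta(dx)=e^{-V(x-\theta)}dx$, $\theta\in\mathbb{R}^d$. Under $\mathbb{P}_\theta$, $X_1,\dots,X_n$ are i.i.d. with law $P_\theta$; $\xi$ denotes a random vector with law $P$. An estimator is any measurable real-valued function of $(X_1,\dots,X_n)$. $V',V''$ are the gradient and Hessian of $V$, and $f'$ is the gradient of $f$; $\mathcal{I}:=\mathbb{E}V'(\xi)\otimes V'(\xi)$ is the Fisher information matrix (under Assumption 1 it equals $\mathbb{E}V''(\xi)$). $\|\cdot\|$ is the Euclidean norm of vectors and the operator norm of matrices and multilinear forms; $a\vee b=\max(a,b)$. Assumption 1 (constants $M,L,m>0$): (i) $V$ is strictly convex and twice continuously differentiable with $\|V''\|_{L_\infty}=\sup_x\|V''(x)\|\le M$ and $\|V''\|_{\rm Lip}=\sup_{x\ne y}\|V''(x)-V''(y)\|/\|x-y\|\le L$; (ii) $\mathcal{I}\succeq mI_d$. Hölder norm: for $s=l+\rho$, $l\ge0$ an integer, $\rho\in(0,1]$, and $f:\mathbb{R}^d\to\mathbb{R}$ that is $l$ times differentiable, $\|f\|_{C^s}:=\max_{0\le j\le l}\sup_x\|f^{(j)}(x)\|\vee\sup_{x\neq y}\frac{\|f^{(l)}(x)-f^{(l)}(y)\|}{\|x-y\|^\rho}$; $f\in C^s$ means this is finite. *)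

(* Defs.v *)
From HB Require Import structures.
From mathcomp Require Import all_boot all_order all_algebra.
From mathcomp Require Import all_classical all_reals all_analysis.

Set Implicit Arguments.
Unset Strict Implicit.
Unset Printing Implicit Defensive.

Import Order.TTheory GRing.Theory Num.Theory.
Import numFieldNormedType.Exports.

Local Open Scope classical_set_scope.
Local Open Scope ring_scope.

Section tuple_measure_step.
Context d (T : measurableType d) (R : realType) (n : nat).
Variables (mu : {sigma_finite_measure set T -> \bar R})
          (nu : {sigma_finite_measure set n.-tuple T -> \bar R}).

Definition tcons (xt : T * n.-tuple T) : n.+1.-tuple T :=
  [tuple of xt.1 :: xt.2].

Lemma measurable_tcons : measurable_fun [set: T * n.-tuple T] tcons.
Proof. exact: measurable_cons. Qed.

Definition tuple_measure_succ : set (n.+1.-tuple T) -> \bar R :=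
  pushforward (mu \x nu)%E tcons.

Let succ0 : tuple_measure_succ set0 = 0%E.
Proof. by rewrite /tuple_measure_succ /pushforward preimage_set0 measure0. Qed.

Let succ_ge0 A : (0 <= tuple_measure_succ A)%E.
Proof. by rewrite /tuple_measure_succ /pushforward; exact: measure_ge0. Qed.

Let succ_sigma_additive : semi_sigma_additive tuple_measure_succ.
Proof.
move=> F mF tF mUF; rewrite /tuple_measure_succ /pushforward preimage_bigcup.
have mp A : measurable A -> measurable (tcons @^-1` A).
  by move=> mA; rewrite -[X in measurable X]setTI; exact: measurable_tcons.
apply: measure_semi_sigma_additive.
- by move=> i; exact: mp.
- apply/trivIsetP => /= i j _ _ ij; rewrite -preimage_setI.
  by move/trivIsetP : tF => /(_ _ _ _ _ ij) ->//; rewrite preimage_set0.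
- by rewrite -preimage_bigcup; exact: mp.
Qed.

HB.instance Definition _ := isMeasure.Build _ _ _ tuple_measure_succ
  succ0 succ_ge0 succ_sigma_additive.

Let succ_sigma_finite : sigma_finite setT tuple_measure_succ.
Proof.
have /sigma_finiteP[F [TF ndF Foo]] := sigma_finiteT mu.
have /sigma_finiteP[G [TG ndG Goo]] := sigma_finiteT nu.
pose un (t : n.+1.-tuple T) : T * n.-tuple T := (thead t, [tuple of behead t]).
have unK : cancel tcons un.
  by move=> [x t]; rewrite /un /tcons theadE; congr (_, _); exact: val_inj.
have mun : measurable_fun setT un.
  apply: measurable_fun_pair; first exact: measurable_tnth.
  exact: measurable_behead.
exists (fun k => un @^-1` (F k `*` G k)).
  rewrite -preimage_bigcup -[LHS](preimage_setT un); congr (_ @^-1` _).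
  rewrite -setXTT TF TG predeqE => -[x y]; split.
    move=> [/= [k _ Fkx] [l _ Gly]]; exists (maxn k l) => //; split.
    - by move: x Fkx; exact/subsetPset/ndF/leq_maxl.
    - by move: y Gly; exact/subsetPset/ndG/leq_maxr.
  by move=> [k _ []/= ? ?]; split; exists k.
move=> k; have [mF Fk] := Foo k; have [mG Gk] := Goo k; split.
  rewrite -[X in measurable X]setTI; apply: mun => //; exact: measurableX.
rewrite /tuple_measure_succ /pushforward.
rewrite (_ : _ @^-1` _ = F k `*` G k); last first.
  by rewrite -comp_preimage (_ : un \o tcons = id) ?preimage_id//; exact/funext.
by rewrite product_measure1E// lte_mul_pinfty// ge0_fin_numE.
Qed.

HB.instance Definition _ := Measure_isSigmaFinite.Build _ _ _
  tuple_measure_succ succ_sigma_finite.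

End tuple_measure_step.

Fixpoint tuple_measure d (T : measurableType d) (R : realType)
    (mu : {sigma_finite_measure set T -> \bar R}) (n : nat) :
    {sigma_finite_measure set n.-tuple T -> \bar R} :=
  match n with
  | 0 => \d_([tuple] : 0.-tuple T)
  | k.+1 => tuple_measure_succ mu (tuple_measure mu k)
  end.

(* The sigma-algebra on row vectors is the one generated by the coordinates,
   i.e. the d-fold product of the Borel sigma-algebra of R. *)
Definition rV_display : measure_display.
Proof. exact: default_measure_display. Qed.

Section measurable_rV.
Context (R : realType) (d : nat).

Let coor (i : 'I_d) (x : 'rV[R]_d) : R := x ord0 i.

Let rV_set0 : g_sigma_preimage coor set0.
Proof. exact: sigma_algebra0. Qed.

Let rV_setC A : g_sigma_preimage coor A -> g_sigma_preimage coor (~` A).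
Proof. exact: sigma_algebraC. Qed.

Let rV_bigcup (F : (set 'rV[R]_d)^nat) :
  (forall i, g_sigma_preimage coor (F i)) ->
  g_sigma_preimage coor (\bigcup_i (F i)).
Proof. exact: sigma_algebra_bigcup. Qed.

HB.instance Definition _ := @isMeasurable.Build rV_display
  'rV[R]_d (g_sigma_preimage coor) rV_set0 rV_setC rV_bigcup.

End measurable_rV.

Section lebesgue_rV.
Context (R : realType) (d : nat).

Definition row_of_tuple (t : d.-tuple (measurableTypeR R)) : 'rV[R]_d :=
  \row_i tnth t i.

Lemma measurable_row_of_tuple : measurable_fun setT row_of_tuple.
Proof.
pose coor (i : 'I_d) (x : 'rV[R]_d) : R := x ord0 i.
move=> _ A mA; rewrite setTI.
suff : preimage_set_system setT row_of_tuple (g_sigma_preimage coor) `<=`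
       measurable.
  by apply; exists A => //; rewrite setTI.
rewrite -g_sigma_preimage_comp => B; congr (_ B); congr (<<s _ >>).
apply: eq_bigr => i _; congr (preimage_set_system _ _ _).
by apply/funext => t /=; rewrite /coor mxE.
Qed.

Definition lebesgue_rV : set 'rV[R]_d -> \bar R :=
  pushforward (tuple_measure (@lebesgue_measure R) d) row_of_tuple.

Let leb0 : lebesgue_rV set0 = 0%E.
Proof. by rewrite /lebesgue_rV /pushforward preimage_set0 measure0. Qed.

Let leb_ge0 A : (0 <= lebesgue_rV A)%E.
Proof. by rewrite /lebesgue_rV /pushforward; exact: measure_ge0. Qed.

Let leb_sigma_additive : semi_sigma_additive lebesgue_rV.
Proof.
move=> F mF tF mUF; rewrite /lebesgue_rV /pushforward preimage_bigcup.
have mp A : measurable A -> measurable (row_of_tuple @^-1` A).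
  by move=> mA; rewrite -[X in measurable X]setTI; exact: measurable_row_of_tuple.
apply: measure_semi_sigma_additive.
- by move=> i; exact: mp.
- apply/trivIsetP => /= i j _ _ ij; rewrite -preimage_setI.
  by move/trivIsetP : tF => /(_ _ _ _ _ ij) ->//; rewrite preimage_set0.
- by rewrite -preimage_bigcup; exact: mp.
Qed.

HB.instance Definition _ := isMeasure.Build _ _ _ lebesgue_rV
  leb0 leb_ge0 leb_sigma_additive.

End lebesgue_rV.
Arguments lebesgue_rV : clear implicits.

Definition has_density (R : realType) (d : nat)
    (P : set 'rV[R]_d -> \bar R) (p : 'rV[R]_d -> R) : Prop :=
  forall A, measurable A -> P A = (\int[lebesgue_rV R d]_(x in A) (p x)%:E)%E.

(* The library norm `|_| on 'rV[R]_d is the sup norm; it induces the same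
   topology (hence the same notions of differentiability and continuity), but
   all quantitative bounds below use the Euclidean norm. *)
Section vector_calculus.
Context (R : realType) (d : nat).
Implicit Types (u v x : 'rV[R]_d) (A B : 'M[R]_d).

Definition dotp u v : R := \sum_i u ord0 i * v ord0 i.

Definition enorm v : R := Num.sqrt (dotp v v).

(* Matrices act on row vectors, so this is the operator norm of A^T, which equals
   that of A. *)
Definition opnorm A : R :=
  sup [set enorm (v *m A) | v in [set v | enorm v <= 1]].

Definition loewner_le A B : Prop := forall v, 0 <= dotp (v *m (B - A)) v.

Definition grad (f : 'rV[R]_d -> R) x : 'rV[R]_d :=
  \row_i 'D_(delta_mx ord0 i) f x.

Definition hess (f : 'rV[R]_d -> R) x : 'M[R]_d := jacobian (grad f) x.

Definition twice_continuously_differentiable (f : 'rV[R]_d -> R) : Prop :=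
  [/\ forall x, differentiable f x,
      forall x, differentiable (grad f) x
    & continuous (hess f)].

Definition strictly_convex (f : 'rV[R]_d -> R) : Prop :=
  forall x y (t : R), x != y -> 0 < t -> t < 1 ->
    f (t *: x + (1 - t) *: y) < t * f x + (1 - t) * f y.

(* Below, N is the norm of the space W of values; all sups are in \bar R. *)
Definition sup_norm (W : Type) (N : W -> R) (F : 'rV[R]_d -> W) : \bar R :=
  ereal_sup [set (N (F x))%:E | x in [set: 'rV[R]_d]].

Definition holder_seminorm (W : zmodType) (N : W -> R) (rho : R)
    (F : 'rV[R]_d -> W) : \bar R :=
  ereal_sup [set (N (F xy.1 - F xy.2) / enorm (xy.1 - xy.2) `^ rho)%:E
            | xy in [set xy : 'rV[R]_d * 'rV[R]_d | xy.1 != xy.2]].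

Definition lip_seminorm (W : zmodType) (N : W -> R) (F : 'rV[R]_d -> W) :=
  holder_seminorm N 1 F.

(* The norm of C^s for s = 1 + rho with 0 < rho <= 1, so that l = 1. *)
Definition C1_holder_norm (rho : R) (f : 'rV[R]_d -> R) : \bar R :=
  maxe (maxe (sup_norm Num.norm f) (sup_norm enorm (grad f)))
       (holder_seminorm enorm rho (grad f)).

Definition C1_holder (rho : R) (f : 'rV[R]_d -> R) : Prop :=
  (forall x, differentiable f x) /\ (C1_holder_norm rho f < +oo)%E.

End vector_calculus.

Section model.
Context (R : realType) (d : nat).
Implicit Types (V f : 'rV[R]_d -> R) (P : probability 'rV[R]_d R).

Definition fisher_info P V : 'M[R]_d :=
  \matrix_(i, j) fine 'E_P[fun x => grad V x ord0 i * grad V x ord0 j].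

(* [P] is the law e^{-V(x)}dx of the noise. *)
Record assumption1 P V (M L m : R) : Prop := Assumption1 {
  a1_strictly_convex : strictly_convex V ;
  a1_C2 : twice_continuously_differentiable V ;
  a1_hess_bounded : (sup_norm (@opnorm R d) (hess V) <= M%:E)%E ;
  a1_hess_lipschitz : (lip_seminorm (@opnorm R d) (hess V) <= L%:E)%E ;
  a1_fisher : loewner_le m%:M (fisher_info P V) }.

Definition sigma_f (I : 'M[R]_d) f (theta : 'rV[R]_d) : R :=
  Num.sqrt (dotp (grad f theta *m invmx I) (grad f theta)).

Definition estimators (n : nat) : set (n.-tuple 'rV[R]_d -> R) :=
  [set T | measurable_fun setT T].

(* [Ptheta] is the law of one observation under the parameter [theta], so that
   [tuple_measure Ptheta n] is the law of the sample. The quotients are taken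
   in \bar R, where x / 0 = +oo for 0 < x and 0 / 0 = 0. *)
Definition normalized_risk (n : nat) (Ptheta : probability 'rV[R]_d R)
    (sigma ftheta : R) (T : n.-tuple 'rV[R]_d -> R) : \bar R :=
  ((Num.sqrt n%:R)%:E
   * Lnorm (tuple_measure Ptheta n) 2%:E (fun X => (T X - ftheta)%:E)
   / sigma%:E)%E.

End model.
Arguments estimators : clear implicits.

(* Main.v *)
(** The lower bound is obtained without the van Trees inequality.  Restrict to
    the segment theta_t = theta0 + t u, |t| <= 1, where u points in the
    direction I^-1 f'(theta0) and has length c / sqrt n.  If the quadratic risk
    of the estimator is at most r^2 on the segment, then its mean g(t) is
    within r of f(theta_t), and a Hellinger form of the Cramer-Rao inequality
    bounds the speed of g by r sqrt (n <I u, u>); hence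
      f(theta_1) - f(theta_-1) <= 2 r (sqrt (n <I u, u>) + 2),
    while smoothness of f bounds the left-hand side from below.  The loss
    compared with a Bayesian argument with an optimal prior is absorbed by the
    constant 3 pi / sqrt 8.

    The squared Hellinger distance of P_theta and P_(theta + v) is at most
    (sqrt <I v, v> + M |v|^2)^2 / 4, by the logarithmic mean inequality and
    translation invariance of the Lebesgue measure; this needs no integration
    by parts and no moment beyond the Fisher information. *)
Require Import Defs.
From HB Require Import structures.
From mathcomp Require Import all_boot all_order all_algebra.
From mathcomp Require Import all_classical all_reals all_analysis.
From mathcomp Require Import measurable_realfun ring lra.

Set Implicit Arguments.
Unset Strict Implicit.
Unset Printing Implicit Defensive.

Import Order.TTheory GRing.Theory Num.Theory.
Import numFieldNormedType.Exports.
Import HBNNSimple.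

Local Open Scope classical_set_scope.
Local Open Scope ring_scope.

(** * Integrals and second moments *)

(** By monotone convergence it suffices to treat the simple functions that approximate [F]. For
    these the claim reduces to [nuE] on level sets. *)
Lemma ge0_integral_density d (T : measurableType d) (R : realType)
    (mu nu : {measure set T -> \bar R}) (p : T -> R) (F : T -> \bar R) :
  (forall x, 0 <= p x) -> measurable_fun [set: T] p ->
  (forall A, measurable A -> nu A = \int[mu]_(x in A) (p x)%:E)%E ->
  (forall x, 0 <= F x)%E -> measurable_fun [set: T] F ->
  (\int[nu]_x F x = \int[mu]_x (F x * (p x)%:E))%E.
Proof.
move=> p0 mp nuE F0 mF.
have mpE : measurable_fun [set: T] (EFin \o p) by exact/measurable_EFinP.
pose h := nnsfun_approx measurableT mF.
have hF x : (h n x)%:E @[n --> \oo] --> F x by exact: cvg_nnsfun_approx.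
have hnd x : {homo (fun n => (h n x)%:E) : a b / (a <= b)%N >-> (a <= b)%E}.
  by move=> a b ab; rewrite lee_fin; exact/lefP/nd_nnsfun_approx.
have mh n : measurable_fun [set: T] (fun x => (h n x)%:E).
  exact/measurable_EFinP.
transitivity (limn (fun n => \int[nu]_x (h n x)%:E)%E).
  under eq_integral => x _ do rewrite -(cvg_lim _ (hF x))//.
  by apply: monotone_convergence => // n x _; rewrite lee_fin.
transitivity (limn (fun n => \int[mu]_x ((h n x)%:E * (p x)%:E))%E); last first.
  transitivity (\int[mu]_x limn (fun n => (h n x)%:E * (p x)%:E))%E; last first.
    by apply: eq_integral => x _; apply: cvg_lim => //; exact: cvgeZr.
  rewrite monotone_convergence//.
  - by move=> n; apply: emeasurable_funM.
  - by move=> n x _; rewrite mule_ge0// lee_fin.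
  - by move=> x _ a b ab; rewrite lee_wpmul2r ?lee_fin//; exact: hnd.
apply: congr_lim; apply/funext => n.
have hE x : ((h n x)%:E =
    \sum_(y \in range (h n)) (y * \1_(h n @^-1` [set y]) x)%:E)%E.
  by rewrite fimfunE -fsumEFin.
(* This serves twice: for [nu] with [q = 1], and for [mu] with [q = p]. *)
have hsum (m : {measure set T -> \bar R}) (q : T -> \bar R) :
    (forall x, 0 <= q x)%E -> measurable_fun [set: T] q ->
  (\int[m]_x ((h n x)%:E * q x) = \sum_(y \in range (h n))
     y%:E * \int[m]_(x in h n @^-1` [set y]) q x)%E.
  move=> q0 mq.
  under eq_integral => x _.
    rewrite hE ge0_mule_fsuml; last by move=> y; exact: nnfun_muleindic_ge0.
    over.
  rewrite ge0_integral_fsum//; last 2 first.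
  - move=> y; apply: emeasurable_funM => //.
    by apply/measurable_EFinP; exact: measurable_funM.
  - by move=> y x _; rewrite mule_ge0// nnfun_muleindic_ge0.
  apply: eq_fsbigr => r /[!inE] -[t _ <-].
  under eq_integral do rewrite EFinM -muleA.
  rewrite ge0_integralZl//; last 3 first.
  - by apply: emeasurable_funM => //; exact/measurable_EFinP.
  - by move=> x _; rewrite mule_ge0// lee_fin.
  - by rewrite lee_fin.
  congr (_ * _)%E; rewrite [RHS]integral_mkcond; apply: eq_integral => x _.
  by rewrite epatch_indic muleC.
have := hsum nu (cst 1%E); under eq_integral do rewrite mule1.
move=> ->//; rewrite hsum//.
apply: eq_fsbigr => r _.
by rewrite integral_cst// mul1e nuE.
Qed.

Section ge0_real_integral.
Context d (T : measurableType d) (R : realType).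
Variable mu : {measure set T -> \bar R}.
Implicit Types f g : T -> R.

Lemma ge0_integralD_EFin f g : (forall x, 0 <= f x) -> (forall x, 0 <= g x) ->
  measurable_fun [set: T] f -> measurable_fun [set: T] g ->
  (\int[mu]_x (f x + g x)%:E = \int[mu]_x (f x)%:E + \int[mu]_x (g x)%:E)%E.
Proof.
move=> f0 g0 mf mg; under eq_integral do rewrite EFinD.
by apply: ge0_integralD => //;
  [move=> x _; rewrite lee_fin|exact/measurable_EFinP|
   move=> x _; rewrite lee_fin|exact/measurable_EFinP].
Qed.

Lemma ge0_integralZ_EFin f k : 0 <= k -> (forall x, 0 <= f x) ->
  measurable_fun [set: T] f ->
  (\int[mu]_x (k * f x)%:E = k%:E * \int[mu]_x (f x)%:E)%E.
Proof.
move=> k0 f0 mf; under eq_integral do rewrite EFinM.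
by apply: ge0_integralZl => //;
  [exact/measurable_EFinP|move=> x _; rewrite lee_fin].
Qed.

Lemma ge0_le_integral_EFin f g : (forall x, 0 <= f x) ->
  measurable_fun [set: T] f -> measurable_fun [set: T] g ->
  (forall x, f x <= g x) -> (\int[mu]_x (f x)%:E <= \int[mu]_x (g x)%:E)%E.
Proof.
move=> f0 mf mg fg; apply: ge0_le_integral => //.
- by move=> x _; rewrite lee_fin.
- exact/measurable_EFinP.
- exact/measurable_EFinP.
- by move=> x _; rewrite lee_fin.
Qed.

Lemma integral_cst_EFin k : mu setT = 1%E ->
  (\int[mu]_x (k : R)%:E = k%:E)%E.
Proof. by move=> mu1; rewrite integral_cst// mu1 mule1. Qed.

End ge0_real_integral.

Section second_moment.
Context d (T : measurableType d) (R : realType).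
Variables (Q : {measure set T -> \bar R}) (X : T -> R).
Hypotheses (Q1 : Q setT = 1%E) (mX : measurable_fun [set: T] X).

Lemma measurable_sqr_sub b : measurable_fun [set: T] (fun x => (X x - b) ^+ 2).
Proof.
apply: (@measurable_funX _ _ _ _ (fun x => X x - b)).
exact: measurable_funB.
Qed.

(** Since [X^2 <= 2 (X - a)^2 + 2 a^2], finite risk about any centre gives a finite second moment,
    so the mean of the estimator is a genuine integral. *)
Lemma second_moment_lty a :
  (\int[Q]_x ((X x - a) ^+ 2)%:E < +oo)%E -> (\int[Q]_x (X x ^+ 2)%:E < +oo)%E.
Proof.
move=> Xaoo; have mXa := measurable_sqr_sub a.
have Xa0 x : 0 <= (X x - a) ^+ 2 by rewrite sqr_ge0.
have a0 : 0 <= 2 * a ^+ 2 by rewrite mulr_ge0// sqr_ge0.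
have Xa0' x : 0 <= 2 * (X x - a) ^+ 2 by rewrite mulr_ge0// sqr_ge0.
apply: (@le_lt_trans _ _
   (\int[Q]_x (2 * (X x - a) ^+ 2 + 2 * a ^+ 2)%:E)%E).
  apply: ge0_le_integral_EFin.
  - by move=> x; exact: sqr_ge0.
  - exact: measurable_funX.
  - by apply: measurable_funD => //; exact: measurable_funM.
  - by move=> x; have := sqr_ge0 (X x - 2 * a); nra.
rewrite (ge0_integralD_EFin Q Xa0' (fun=> a0))//; last exact: measurable_funM.
rewrite ge0_integralZ_EFin// integral_cst_EFin//.
by rewrite lte_add_pinfty ?ltry// lte_mul_pinfty.
Qed.

Hypothesis X2oo : (\int[Q]_x (X x ^+ 2)%:E < +oo)%E.

Lemma integrable_sqr : Q.-integrable setT (EFin \o (fun x => X x ^+ 2)).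
Proof.
apply/integrableP; split.
  by apply/measurable_EFinP; exact: measurable_funX.
rewrite (eq_integral (fun x => (X x ^+ 2)%:E))// => x _.
by rewrite gee0_abs// lee_fin sqr_ge0.
Qed.

Lemma integrable_cst1 (k : R) : Q.-integrable setT (EFin \o cst k).
Proof.
apply/integrableP; split; first exact/measurable_EFinP.
by rewrite (eq_integral (fun x => `|k|%:E))// integral_cst_EFin ?ltry.
Qed.

Lemma square_integrable_integrable : Q.-integrable setT (EFin \o X).
Proof.
apply: (@le_integrable _ _ _ _ _ measurableT _
  (EFin \o (fun x => 1 + X x ^+ 2))).
- exact/measurable_EFinP.
- move=> x _ /=; rewrite lee_fin [leRHS]ger0_norm ?addr_ge0 ?sqr_ge0//.
  by rewrite ler_norml; have := sqr_ge0 (X x - 1); have := sqr_ge0 (X x + 1); nra.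
- rewrite (_ : _ \o _ = (EFin \o cst 1) \+ (EFin \o (fun x => X x ^+ 2)))//.
  by apply: integrableD => //; [exact: integrable_cst1|exact: integrable_sqr].
Qed.

Lemma second_momentE b : (\int[Q]_x ((X x - b) ^+ 2)%:E =
  (\int[Q]_x (X x ^+ 2) - 2 * b * \int[Q]_x X x + b ^+ 2)%R%:E)%E.
Proof.
have iX := square_integrable_integrable.
have iX2 := integrable_sqr.
have icX : Q.-integrable setT (EFin \o (fun x => - (2 * b) * X x)).
  rewrite (_ : _ \o _ = (fun x => (- (2 * b))%:E * (EFin \o X) x)%E)//.
  exact: integrableZl.
have ic := integrable_cst1 (b ^+ 2).
have iXc : Q.-integrable setT (EFin \o (fun x => X x ^+ 2 + - (2 * b) * X x)).
  by apply: (integrableD _ iX2 icX).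
have i : Q.-integrable setT (EFin \o (fun x => (X x - b) ^+ 2)).
  rewrite (_ : _ \o _ = EFin \o (fun x => (X x ^+ 2 + - (2 * b) * X x) + b ^+ 2)).
    by apply: (integrableD _ iXc ic).
  by apply/funext => x /=; congr EFin; ring.
rewrite -[LHS]fineK; last exact: (integrable_fin_num _ i).
congr EFin; transitivity (\int[Q]_x ((X x ^+ 2 + - (2 * b) * X x) + b ^+ 2)).
  by apply: eq_Rintegral => x _ /=; ring.
rewrite RintegralD// RintegralD// RintegralZl//.
by rewrite Rintegral_cst// Q1/= mulr1; ring.
Qed.

Lemma sqr_mean_le : (\int[Q]_x X x) ^+ 2 <= \int[Q]_x (X x ^+ 2).
Proof.
set g := \int[Q]_x X x.
have : (0 <= \int[Q]_x ((X x - g) ^+ 2)%:E)%E.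
  by apply: integral_ge0 => x _; rewrite lee_fin sqr_ge0.
by rewrite second_momentE lee_fin -/g; nra.
Qed.

End second_moment.

(** Quadratic risk is variance plus squared bias, and the variance is nonnegative. *)
Lemma bias_le d (T : measurableType d) (R : realType)
    (Q : {measure set T -> \bar R}) (X : T -> R) (a r : R) :
  Q setT = 1%E -> measurable_fun [set: T] X -> 0 <= r ->
  (\int[Q]_x ((X x - a) ^+ 2)%:E <= (r ^+ 2)%:E)%E ->
  `|\int[Q]_x X x - a| <= r.
Proof.
move=> Q1 mX r0 risk.
have lty := second_moment_lty Q1 mX (le_lt_trans risk (ltry _)).
have := sqr_mean_le Q1 mX lty.
move: risk; rewrite (second_momentE Q1 mX lty) lee_fin => risk mean2.
by rewrite -(@ler_pXn2r _ 2)// ?nnegrE// real_normK ?num_real//; nra.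
Qed.


(** * A Cramer-Rao inequality between two measures, in Hellinger form *)

Section two_points.
Context d (T : measurableType d) (R : realType).
Variables (Q0 Q1 : {measure set T -> \bar R}) (s X : T -> R) (H r a0 a1 : R).
Hypotheses (Q01 : Q0 setT = 1%E) (Q11 : Q1 setT = 1%E).
Hypotheses (ms : measurable_fun [set: T] s) (mX : measurable_fun [set: T] X).
Hypothesis Q1E : forall F : T -> \bar R, (forall x, 0 <= F x)%E ->
  measurable_fun [set: T] F ->
  (\int[Q1]_x F x = \int[Q0]_x (F x * (s x ^+ 2)%:E))%E.
Hypothesis sH : (\int[Q0]_x ((s x - 1) ^+ 2)%:E <= H%:E)%E.
Hypothesis risk0 : (\int[Q0]_x ((X x - a0) ^+ 2)%:E <= (r ^+ 2)%:E)%E.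
Hypothesis risk1 : (\int[Q1]_x ((X x - a1) ^+ 2)%:E <= (r ^+ 2)%:E)%E.

(** Here [s ^+ 2] is the density of [Q1] with respect to [Q0], and [H] bounds the squared Hellinger
    distance. The difference of means is the [Q0]-integral of [(X - a) (s - 1) (s + 1)], to which
    Cauchy-Schwarz applies. Both variances are at most [r ^+ 2]; the factor [1 - H] accounts for the
    gap between the two means. *)
Lemma mean_diff_hellinger :
  (\int[Q1]_x X x - \int[Q0]_x X x) ^+ 2 * (1 - H) <= 4 * H * r ^+ 2.
Proof.
have lty0 := second_moment_lty Q01 mX (le_lt_trans risk0 (ltry _)).
have lty1 := second_moment_lty Q11 mX (le_lt_trans risk1 (ltry _)).
have E0 := second_momentE Q01 mX lty0.
have E1 := second_momentE Q11 mX lty1.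
have H0 : 0 <= H.
  rewrite -lee_fin (le_trans _ sH)// integral_ge0// => x _.
  by rewrite lee_fin sqr_ge0.
move: risk0 risk1; rewrite E0 E1 !lee_fin.
set m0 := \int[Q0]_x (X x ^+ 2); set g0 := \int[Q0]_x X x.
set m1 := \int[Q1]_x (X x ^+ 2); set g1 := \int[Q1]_x X x => r0 r1.
have v0 : m0 - g0 ^+ 2 <= r ^+ 2 by have := sqr_ge0 (g0 - a0); nra.
have v1 : m1 - g1 ^+ 2 <= r ^+ 2 by have := sqr_ge0 (g1 - a1); nra.
(* About the midpoint, the two second moments exceed the two variances by only [(g1 - g0)^2 / 2] in
   total, the least possible. *)
pose a := (g0 + g1) / 2.
have msq b : measurable_fun [set: T] (fun x => (X x - b) ^+ 2).
  exact: measurable_sqr_sub.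
have msq1 : measurable_fun [set: T] (fun x => (s x - 1) ^+ 2).
  exact: measurable_sqr_sub.
have ms2 : measurable_fun [set: T] (fun x => s x ^+ 2) by exact: measurable_funX.
(* Pointwise, with T' := X - a, Cauchy-Schwarz with parameter gives
   l T' (s^2 - 1) <= (l^2 / 2) (s - 1)^2 + T'^2 (s^2 + 1); adding T'^2 and
   l^2 / 4 weighted by s^2 + 1 makes both sides nonnegative, so that the change
   of measure is only needed for nonnegative functions. *)
have cs (l : R) : (m1 - 2 * (a - l / 2) * g1 + (a - l / 2) ^+ 2) +
    (m0 - 2 * (a + l / 2) * g0 + (a + l / 2) ^+ 2) <=
    l ^+ 2 / 2 * H + 2 * (m1 - 2 * a * g1 + a ^+ 2) +
    2 * (m0 - 2 * a * g0 + a ^+ 2) + l ^+ 2 / 2.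
  pose A x := (X x - (a - l / 2)) ^+ 2 * s x ^+ 2 + (X x - (a + l / 2)) ^+ 2.
  pose W x := 2 * (X x - a) ^+ 2 + l ^+ 2 / 4.
  pose B x := l ^+ 2 / 2 * (s x - 1) ^+ 2 + (W x * s x ^+ 2 + W x).
  have mW : measurable_fun [set: T] W.
    by apply: measurable_funD => //; exact: measurable_funM.
  have W0 x : 0 <= W x.
    by rewrite /W; have := sqr_ge0 (X x - a); have := sqr_ge0 l; lra.
  have Ws0 x : 0 <= W x * s x ^+ 2 by rewrite mulr_ge0 ?sqr_ge0.
  have mWs : measurable_fun [set: T] (fun x => W x * s x ^+ 2).
    exact: measurable_funM.
  have mXs b : measurable_fun [set: T] (fun x => (X x - b) ^+ 2 * s x ^+ 2).
    exact: measurable_funM.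
  have Xs0 b x : 0 <= (X x - b) ^+ 2 * s x ^+ 2 by rewrite mulr_ge0 ?sqr_ge0.
  have X0 b x : 0 <= (X x - b) ^+ 2 by rewrite sqr_ge0.
  have s0 x : 0 <= (s x - 1) ^+ 2 by rewrite sqr_ge0.
  have l0 : 0 <= l ^+ 2 / 2 by rewrite divr_ge0// sqr_ge0.
  have AB : (\int[Q0]_x (A x)%:E <= \int[Q0]_x (B x)%:E)%E.
    apply: ge0_le_integral_EFin.
    - by move=> x; rewrite addr_ge0.
    - exact: measurable_funD.
    - apply: measurable_funD; first exact: measurable_funM.
      exact: measurable_funD.
    - move=> x; rewrite /A /B /W -subr_ge0.
      rewrite (_ : _ - _ = (l * (s x - 1) - (X x - a) * (s x + 1)) ^+ 2 / 2 +
        ((X x - a) * (s x - 1)) ^+ 2 / 2); last by field.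
      by rewrite addr_ge0// divr_ge0// sqr_ge0.
  have AE : (\int[Q0]_x (A x)%:E = \int[Q1]_x ((X x - (a - l / 2)) ^+ 2)%:E +
      \int[Q0]_x ((X x - (a + l / 2)) ^+ 2)%:E)%E.
    rewrite Q1E; [|by move=> x; rewrite lee_fin|exact/measurable_EFinP].
    exact: ge0_integralD_EFin.
  have WE (Q : {measure set T -> \bar R}) : Q setT = 1%E ->
      (\int[Q]_x (W x)%:E =
       2%:E * \int[Q]_x ((X x - a) ^+ 2)%:E + (l ^+ 2 / 4)%:E)%E.
    move=> QT; have c0 : 0 <= l ^+ 2 / 4 by rewrite divr_ge0// sqr_ge0.
    have W0' x : 0 <= 2 * (X x - a) ^+ 2 by rewrite mulr_ge0.
    rewrite (ge0_integralD_EFin Q W0' (fun=> c0))//; last exact: measurable_funM.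
    by rewrite integral_cst_EFin// ge0_integralZ_EFin.
  have BE : (\int[Q0]_x (B x)%:E = (l ^+ 2 / 2)%:E * \int[Q0]_x ((s x - 1) ^+ 2)%:E
      + (\int[Q1]_x (W x)%:E + \int[Q0]_x (W x)%:E))%E.
    rewrite [in RHS]Q1E; [|by move=> x; rewrite lee_fin|exact/measurable_EFinP].
    rewrite -ge0_integralZ_EFin// -ge0_integralD_EFin// -ge0_integralD_EFin//.
    - by move=> x; rewrite mulr_ge0.
    - by move=> x; rewrite addr_ge0.
    - exact: measurable_funM.
    - exact: measurable_funD.
  have sfin : (\int[Q0]_x ((s x - 1) ^+ 2)%:E \is a fin_num)%E.
    rewrite ge0_fin_numE ?(le_lt_trans sH) ?ltry// integral_ge0// => x _.
    by rewrite lee_fin.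
  move: AB; rewrite AE BE !WE// !E0 !E1 -/m0 -/g0 -/m1 -/g1.
  move: sH; rewrite -(fineK sfin) lee_fin; set i := fine _ => iH.
  by rewrite -!EFinM -!EFinD lee_fin; nra.
have key : forall l : R,
    l * (g1 - g0) * 2 <= l ^+ 2 * H + 4 * r ^+ 2 + (g1 - g0) ^+ 2.
  by move=> l; have := cs l; rewrite /a; nra.
set D := g1 - g0 in key *.
(* For [H = 0] the right-hand side of [key] does not depend on [l], so a large [l] contradicts
   [D != 0]. *)
have [H00|Hn0] := eqVneq H 0.
  rewrite H00 subr0 mulr1 mulr0 mul0r leNgt; apply/negP => D0.
  have Dn0 : D != 0 by apply/eqP => Dz; rewrite Dz expr0n ltxx in D0.
  have := key ((4 * r ^+ 2 + D ^+ 2 + 1) / D / 2).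
  by rewrite H00 mulr0 add0r (_ : _ * D * 2 = 4 * r ^+ 2 + D ^+ 2 + 1); [lra|field].
have Hp : 0 < H by rewrite lt0r Hn0.
(* The choice [l = D / H] minimises [l^2 H - 2 l D]. *)
have := key (D / H).
rewrite (_ : D / H * D * 2 = 2 * (D ^+ 2 / H)); last by field.
rewrite (_ : (D / H) ^+ 2 * H = D ^+ 2 / H); last by field.
move=> h; have : D ^+ 2 / H <= 4 * r ^+ 2 + D ^+ 2 by lra.
by rewrite ler_pdivrMr//; nra.
Qed.

End two_points.

(** * Product measures *)

Section tuple_measure_theory.
Context d (T : measurableType d) (R : realType).
Implicit Types mu : {sigma_finite_measure set T -> \bar R}.

Lemma measurable_tuple_integral mu n (F : n.+1.-tuple T -> \bar R) :
  (forall X, 0 <= F X)%E -> measurable_fun [set: n.+1.-tuple T] F ->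
  measurable_fun [set: T]
    (fun x => \int[tuple_measure mu n]_Y F (tcons (x, Y)))%E.
Proof.
move=> F0 mF.
have mFc : measurable_fun [set: T * n.-tuple T] (F \o @tcons _ T n).
  by apply: measurableT_comp => //; exact: measurable_tcons.
exact: (@measurable_fun_fubini_tonelli_F _ _ _ _ _ (tuple_measure mu n) _ mFc
  (fun z => F0 (tcons z))).
Qed.

Lemma integral_tuple_measureS mu n (F : n.+1.-tuple T -> \bar R) :
  (forall X, 0 <= F X)%E -> measurable_fun [set: n.+1.-tuple T] F ->
  (\int[tuple_measure mu n.+1]_X F X =
   \int[mu]_x \int[tuple_measure mu n]_Y F (tcons (x, Y)))%E.
Proof.
move=> F0 mF.
have mc := @measurable_tcons _ T n.
transitivity
  (\int[pushforward (mu \x tuple_measure mu n)%E (@tcons _ T n)]_X F X)%E.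
  by apply: eq_measure_integral => A mA _.
rewrite ge0_integral_pushforward// preimage_setT.
have mFc : measurable_fun [set: T * n.-tuple T] (F \o @tcons _ T n).
  exact: measurableT_comp.
exact: (fubini_tonelli1 _ mFc (fun z => F0 (tcons z))).
Qed.

Lemma tuple_measure_setT mu n : mu setT = 1%E -> tuple_measure mu n setT = 1%E.
Proof.
move=> mu1; elim: n => [|n IH]; first by rewrite /= diracT.
rewrite -[LHS]mul1e -integral_cst// integral_tuple_measureS//.
transitivity (\int[mu]_x (1%R : R)%:E)%E; last by rewrite integral_cst_EFin.
by apply: eq_integral => x _; exact: integral_cst_EFin.
Qed.

Lemma integral_tuple_measure0 mu (F : 0.-tuple T -> \bar R) :
  measurable_fun [set: 0.-tuple T] F ->
  (\int[tuple_measure mu 0]_X F X = F [tuple])%E.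
Proof. by move=> mF; rewrite /= integral_dirac// diracT mul1e. Qed.

(** For [s] the root of a density ratio of one observation, this is the root of the likelihood ratio
    of the sample. *)
Definition tprod (s : T -> R) n (X : n.-tuple T) : R :=
  \prod_(i < n) s (tnth X i).

Lemma tprod_tcons s n x (Y : n.-tuple T) :
  tprod s (tcons (x, Y)) = s x * tprod s Y.
Proof.
rewrite /tprod big_ord_recl; congr (_ * _); apply: eq_bigr => i _.
by congr s; rewrite /tcons/= tnthS.
Qed.

Lemma measurable_tprod s n : measurable_fun [set: T] s ->
  measurable_fun [set: n.-tuple T] (@tprod s n).
Proof.
move=> ms; rewrite /tprod; apply: measurable_prod => i _.
by apply: measurableT_comp => //; exact: measurable_tnth.
Qed.

Lemma tprod_ge0 s n (X : n.-tuple T) : (forall x, 0 <= s x) -> 0 <= tprod s X.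
Proof. by move=> s0; exact: prodr_ge0. Qed.

(** Tonelli and induction on [n]. Quantifying over nonnegative functions rather than sets lets the
    hypothesis on [mu1] apply to the inner integral, which is a function of the first coordinate. *)
Lemma ge0_integral_tuple_density mu0 mu1 (s : T -> R) n :
  measurable_fun [set: T] s ->
  (forall F : T -> \bar R, (forall x, 0 <= F x)%E -> measurable_fun [set: T] F ->
    \int[mu1]_x F x = \int[mu0]_x (F x * (s x ^+ 2)%:E))%E ->
  (forall F : n.-tuple T -> \bar R, (forall X, 0 <= F X)%E ->
    measurable_fun [set: n.-tuple T] F ->
    \int[tuple_measure mu1 n]_X F X =
    \int[tuple_measure mu0 n]_X (F X * (tprod s X ^+ 2)%:E))%E.
Proof.
move=> ms mu1E; elim: n => [F F0 mF|n IH F F0 mF].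
  rewrite !integral_tuple_measure0//; first by rewrite /tprod big_ord0 expr1n mule1.
  apply: emeasurable_funM => //; apply/measurable_EFinP/measurable_funX.
  exact: measurable_tprod.
have mFc x : measurable_fun [set: n.-tuple T] (fun Y => F (tcons (x, Y))).
  apply: measurableT_comp => //.
  by apply: measurableT_comp => //; exact: measurable_tcons.
have mt k : measurable_fun [set: k.-tuple T] (fun X => (tprod s X ^+ 2)%:E).
  by apply/measurable_EFinP/measurable_funX; exact: measurable_tprod.
have t0 k (X : k.-tuple T) : (0 <= (tprod s X ^+ 2)%:E)%E.
  by rewrite lee_fin sqr_ge0.
rewrite integral_tuple_measureS// integral_tuple_measureS; last 2 first.
- by move=> X; exact: mule_ge0.
- exact: emeasurable_funM mF (mt n.+1).
rewrite mu1E; last 2 first.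
- by move=> x; exact: integral_ge0.
- exact: measurable_tuple_integral.
apply: eq_integral => x _; rewrite IH// muleC -ge0_integralZl//.
- by apply: eq_integral => Y _; rewrite tprod_tcons exprMn EFinM muleCA.
- exact: emeasurable_funM (mFc x) (mt n).
- by move=> Y _; exact: mule_ge0.
- by rewrite lee_fin sqr_ge0.
Qed.

Lemma integral_tprod mu (s : T -> R) (A : R) n :
  measurable_fun [set: T] s -> (forall x, 0 <= s x) ->
  (\int[mu]_x (s x)%:E = A%:E)%E ->
  (\int[tuple_measure mu n]_X (tprod s X)%:E = (A ^+ n)%:E)%E.
Proof.
move=> ms s0 sA; elim: n => [|n IH].
  rewrite integral_tuple_measure0; first by rewrite /tprod big_ord0.
  by apply/measurable_EFinP; exact: measurable_tprod.
rewrite integral_tuple_measureS; last 2 first.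
- by move=> X; rewrite lee_fin; exact: tprod_ge0.
- by apply/measurable_EFinP; exact: measurable_tprod.
transitivity (\int[mu]_x (A ^+ n * s x)%:E)%E.
  apply: eq_integral => x _; under eq_integral do rewrite tprod_tcons.
  rewrite ge0_integralZ_EFin//; last exact: measurable_tprod.
  - by rewrite IH -EFinM mulrC.
  - by move=> Y; exact: tprod_ge0.
have A0 : 0 <= A.
  by rewrite -lee_fin -sA; apply: integral_ge0 => x _; rewrite lee_fin.
by rewrite ge0_integralZ_EFin ?exprn_ge0// sA -EFinM -exprSr.
Qed.

(* The affinity is multiplicative: 2 - 2 A^n <= n (2 - 2 A) by Bernoulli. *)
Lemma hellinger_tuple_measure mu0 mu1 (s : T -> R) (H : R) n :
  mu0 setT = 1%E -> mu1 setT = 1%E ->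
  measurable_fun [set: T] s -> (forall x, 0 <= s x) ->
  (forall F : T -> \bar R, (forall x, 0 <= F x)%E -> measurable_fun [set: T] F ->
    \int[mu1]_x F x = \int[mu0]_x (F x * (s x ^+ 2)%:E))%E ->
  (\int[mu0]_x ((s x - 1) ^+ 2)%:E <= H%:E ->
  \int[tuple_measure mu0 n]_X ((tprod s X - 1) ^+ 2)%:E <= (n%:R * H)%:E)%E.
Proof.
move=> mu0T mu1T ms s0 mu1E sH.
have aff k : (\int[tuple_measure mu0 k]_X (tprod s X ^+ 2)%:E = 1)%E.
  rewrite -(tuple_measure_setT k mu1T) -[RHS]mul1e -integral_cst//.
  rewrite (ge0_integral_tuple_density ms mu1E)//.
  by apply: eq_integral => X _; rewrite mul1e.
(* When [t ^+ 2] has integral one, the squared Hellinger distance is [2 - 2 a], where [a] is the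
   affinity. This is used for one observation and for the sample. *)
have sqE (d' : measure_display) (U : measurableType d')
    (Q : {measure set U -> \bar R}) (t : U -> R) : Q setT = 1%E ->
    measurable_fun [set: U] t -> (forall x, 0 <= t x) ->
    (\int[Q]_x (t x ^+ 2)%:E = 1)%E ->
    exists2 a : R, (\int[Q]_x (t x)%:E = a%:E)%E &
      (\int[Q]_x ((t x - 1) ^+ 2)%:E = (2 - 2 * a)%:E)%E.
  move=> QT mt t0 t2.
  have t2oo : (\int[Q]_x (t x ^+ 2)%:E < +oo)%E by rewrite t2 ltry.
  exists (\int[Q]_x t x).
    rewrite fineK//; apply: integrable_fin_num => //.
    exact: square_integrable_integrable.
  rewrite (second_momentE QT mt t2oo) /Rintegral t2/=.
  by congr EFin; ring.
have s2 : (\int[mu0]_x (s x ^+ 2)%:E = 1)%E.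
  rewrite -mu1T -[RHS]mul1e -integral_cst// mu1E//.
  by apply: eq_integral => X _; rewrite mul1e.
have [a sa] := sqE _ _ mu0 s mu0T ms s0 s2.
move=> sE; move: sH; rewrite sE lee_fin => aH.
have mt : measurable_fun [set: n.-tuple T] (@tprod s n) by exact: measurable_tprod.
have [b sb ->] := sqE _ _ (tuple_measure mu0 n) (@tprod s n)
  (tuple_measure_setT n mu0T) mt (fun X => tprod_ge0 X s0) (aff n).
move: sb; rewrite (integral_tprod n ms s0 sa) => -[<-].
have a0 : 0 <= a.
  by rewrite -lee_fin -sa; apply: integral_ge0 => x _; rewrite lee_fin.
rewrite lee_fin; have : 1 - n%:R * (1 - a) <= a ^+ n.
  elim: n {aff mt} => [|n IH]; first by rewrite mul0r subr0 expr0.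
  rewrite exprS -natr1.
  have [a1|a1] := leP a 1.
    have : 0 <= n%:R * (1 - a) * (1 - a) by rewrite !mulr_ge0// subr_ge0.
    have := ler_wpM2l a0 IH; lra.
  have : 0 <= n%:R * (1 - a) * (1 - a).
    by rewrite -mulrA mulr_ge0// -expr2 sqr_ge0.
  by have := ler_wpM2l a0 IH; lra.
have : 0 <= n%:R :> R by [].
by nra.
Qed.

End tuple_measure_theory.

(** * Lebesgue measure on row vectors *)

Section lebesgue_translation.
Context (R : realType).

Let rshift (a : R) : measurableTypeR R -> measurableTypeR R :=
  fun x : R => x + a.

Let measurable_rshift a : measurable_fun [set: measurableTypeR R] (rshift a).
Proof. exact: measurable_funD. Qed.

(** The image of Lebesgue measure under a shift gives half-open intervals their length, and this
    characterises Lebesgue measure. *)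
Lemma lebesgue_measure_translation (a : R) (A : set (measurableTypeR R)) :
  measurable A -> lebesgue_measure (rshift a @^-1` A) = lebesgue_measure A.
Proof.
move=> mA; symmetry; have mr := measurable_rshift a.
apply: (@lebesgue_measure_unique R (pushforward lebesgue_measure (rshift a))) => //.
move=> _ [[b c] _ <-] /=; rewrite /pushforward.
rewrite (_ : rshift a @^-1` _ = `]b - a, c - a]%classic).
  rewrite !lebesgue_measure_itv/= !lte_fin ltrD2r -!EFinB.
  by rewrite opprB addrA addrNK.
by apply/seteqP; split => x /=; rewrite !in_itv/= ltrBlDr lerBrDr.
Qed.

Lemma ge0_integral_lebesgue_translation (a : R)
    (F : measurableTypeR R -> \bar R) :
  (forall x, 0 <= F x)%E -> measurable_fun [set: measurableTypeR R] F ->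
  (\int[@lebesgue_measure R]_x F (rshift a x) = \int[@lebesgue_measure R]_x F x)%E.
Proof.
move=> F0 mF; have mr := measurable_rshift a.
transitivity (\int[pushforward lebesgue_measure (rshift a)]_x F x)%E.
  by rewrite ge0_integral_pushforward// preimage_setT.
by apply: eq_measure_integral => A mA _; exact: lebesgue_measure_translation.
Qed.

Definition tshift n (a : 'I_n -> R) (t : n.-tuple (measurableTypeR R)) :
  n.-tuple (measurableTypeR R) := [tuple rshift (a i) (tnth t i) | i < n].

Lemma measurable_tshift n (a : 'I_n -> R) :
  measurable_fun [set: n.-tuple (measurableTypeR R)] (tshift a).
Proof.
apply/measurable_fun_tnthP => i; rewrite (_ : _ \o _ =
    rshift (a i) \o (@tnth _ (measurableTypeR R) ^~ i)); last first.
  by apply/funext => t; rewrite /= tnth_mktuple.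
by apply: measurableT_comp => //; exact: measurable_tnth.
Qed.

Lemma ge0_integral_tuple_lebesgue_translation n (a : 'I_n -> R)
    (F : n.-tuple (measurableTypeR R) -> \bar R) :
  (forall x, 0 <= F x)%E ->
  measurable_fun [set: n.-tuple (measurableTypeR R)] F ->
  (\int[tuple_measure (@lebesgue_measure R) n]_t F (tshift a t) =
   \int[tuple_measure (@lebesgue_measure R) n]_t F t)%E.
Proof.
elim: n a F => [|n IH] a F F0 mF.
  by apply: eq_integral => t _; congr F; rewrite [LHS]tuple0 [RHS]tuple0.
have mFa : measurable_fun [set: n.+1.-tuple (measurableTypeR R)]
    (fun t => F (tshift a t)).
  by apply: measurableT_comp => //; exact: measurable_tshift.
rewrite !integral_tuple_measureS//.
have mFc x : measurable_fun [set: n.-tuple (measurableTypeR R)]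
    (fun Y => F (tcons (x, Y))).
  apply: measurableT_comp => //.
  by apply: measurableT_comp => //; exact: measurable_tcons.
transitivity (\int[@lebesgue_measure R]_x
   \int[tuple_measure (@lebesgue_measure R) n]_Y
     F (tcons (rshift (a ord0) x, Y)))%E.
  apply: eq_integral => x _; rewrite -[RHS](IH (a \o lift ord0))//.
  apply: eq_integral => Y _; congr F; apply: eq_from_tnth => i.
  rewrite tnth_mktuple; case: (unliftP ord0 i) => [j|] ->.
    by rewrite /tcons/= !tnthS tnth_mktuple.
  by rewrite /tcons/= !tnth0.
rewrite (ge0_integral_lebesgue_translation _ (F := fun x =>
   \int[tuple_measure (@lebesgue_measure R) n]_Y F (tcons (x, Y)))%E)//.
  by move=> x; exact: integral_ge0.
exact: measurable_tuple_integral.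
Qed.

End lebesgue_translation.

Section measurable_row_vectors.
Context (R : realType) (d : nat).

Lemma measurable_coord (i : 'I_d) :
  measurable_fun [set: 'rV[R]_d] (fun x : 'rV[R]_d => x ord0 i).
Proof.
move=> _ A mA; rewrite setTI; apply: sub_sigma_algebra => /=.
rewrite -bigcup_seq/=; exists i => /=; first by rewrite mem_index_enum.
by exists A => //; rewrite setTI.
Qed.

Lemma measurable_fun_rV d' (T : measurableType d') (f : T -> 'rV[R]_d) :
  (forall i, measurable_fun [set: T] (fun t => f t ord0 i)) ->
  measurable_fun [set: T] f.
Proof.
move=> mf; pose g t : d.-tuple (measurableTypeR R) := [tuple f t ord0 i | i < d].
rewrite (_ : f = @row_of_tuple R d \o g).
  apply: measurableT_comp; first exact: measurable_row_of_tuple.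
  apply/measurable_fun_tnthP => i.
  rewrite (_ : _ \o _ = fun t => f t ord0 i); first exact: mf.
  by apply/funext => t /=; rewrite tnth_mktuple.
by apply/funext => t; apply/rowP => i /=; rewrite mxE tnth_mktuple.
Qed.

Lemma measurable_translation_rV (a : 'rV[R]_d) :
  measurable_fun [set: 'rV[R]_d] (fun x : 'rV[R]_d => x + a).
Proof.
apply: measurable_fun_rV => i; under eq_fun do rewrite mxE.
by apply: measurable_funD => //; exact: measurable_coord.
Qed.

Lemma ge0_integral_lebesgue_rV_translation (a : 'rV[R]_d) (F : 'rV[R]_d -> \bar R) :
  (forall x, 0 <= F x)%E -> measurable_fun [set: 'rV[R]_d] F ->
  (\int[lebesgue_rV R d]_x F (x + a)%R = \int[lebesgue_rV R d]_x F x)%E.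
Proof.
move=> F0 mF.
have mr := @measurable_row_of_tuple R d.
have ma := measurable_translation_rV a.
have mFa : measurable_fun [set: 'rV[R]_d] (fun x : 'rV[R]_d => F (x + a)).
  exact: measurableT_comp mF ma.
have E (G : 'rV[R]_d -> \bar R) : (forall x, 0 <= G x)%E ->
    measurable_fun [set: 'rV[R]_d] G ->
    (\int[lebesgue_rV R d]_x G x =
     \int[tuple_measure (@lebesgue_measure R) d]_t G (@row_of_tuple R d t))%E.
  move=> G0 mG.
  transitivity (\int[pushforward (tuple_measure (@lebesgue_measure R) d)
    (@row_of_tuple R d)]_x G x)%E; first exact: eq_measure_integral.
  by rewrite ge0_integral_pushforward// preimage_setT.
rewrite !E//.
rewrite -[RHS](ge0_integral_tuple_lebesgue_translation (fun i => a ord0 i))//.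
- by apply: eq_integral => t _; congr F; apply/rowP => i; rewrite !mxE tnth_mktuple.
- exact: measurableT_comp mF mr.
Qed.

(** The sigma-algebra is generated by coordinates, so its link with the topology has to be proved:
    an open set is a countable union of cubes with rational centres and radii [1 / (k + 1)]. *)
Lemma open_measurable_rV (A : set 'rV[R]_d) : open A -> measurable A.
Proof.
move=> oA.
pose box (q : 'rV[rat]_d) (k : nat) : set 'rV[R]_d :=
  [set x | forall i, `|x ord0 i - ratr (q ord0 i)| < k.+1%:R^-1].
have mbox q k : measurable (box q k).
  rewrite (_ : box q k = \bigcap_(i in [set: 'I_d])
     ((fun x : 'rV[R]_d => x ord0 i) @^-1`
       `](ratr (q ord0 i) - k.+1%:R^-1), (ratr (q ord0 i) + k.+1%:R^-1)[)); last first.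
    apply/seteqP; split => x /= h i.
      by move=> _; rewrite /= in_itv/= -ltr_distl.
    by have := h i Logic.I; rewrite /= in_itv/= -ltr_distl.
  apply: fin_bigcap_measurable => //.
  by move=> i _; rewrite -[X in measurable X]setTI; exact: measurable_coord.
(* Centres and radii are enumerated by [unpickle]; codes of no cube, or of a cube not inside [A],
   contribute the empty set. *)
pose S (n : nat) : set 'rV[R]_d :=
  if @unpickle ('rV[rat]_d * nat)%type n is Some (q, k)
  then if pselect (box q k `<=` A) then box q k else set0 else set0.
have -> : A = \bigcup_n S n.
  apply/seteqP; split => [x Ax|x [n _]]; last first.
    by rewrite /S; case: unpickle => [[q k]|//]; case: pselect => [qA /qA|//].
  have /nbhs_ballP[e/= e0 eA] := open_nbhs_nbhs (conj oA Ax).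
  have [k ke] : exists k : nat, k.+1%:R^-1 < e / 2.
    have e20 : 0 < e / 2 by rewrite divr_gt0.
    have [k _ /(_ k (leqnn k)) hk] := near_infty_natSinv_lt (PosNum e20).
    by exists k.
  have /choice[q hq] : forall i : 'I_d, exists q : rat,
      `|x ord0 i - ratr q| < k.+1%:R^-1.
    move=> i; have kp : 0 < k.+1%:R^-1 :> R by rewrite invr_gt0.
    have [|q] := @rat_in_itvoo R (x ord0 i - k.+1%:R^-1) (x ord0 i + k.+1%:R^-1).
      by rewrite ltrD2l (lt_trans _ kp)// oppr_lt0.
    by rewrite in_itv/= => qx; exists q; rewrite distrC ltr_distl.
  pose Q : 'rV[rat]_d := \row_i q i.
  have xQ : box Q k x by move=> i; rewrite /Q mxE.
  exists (pickle (Q, k)) => //; rewrite /S pickleK.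
  case: pselect => //= -[] y yQ; apply: eA.
  (* Balls of the topology are those of the sup norm, so the distance is checked coordinate by
     coordinate. *)
  rewrite /ball/=; split => // i j; rewrite (ord1 i) /ball/=.
  rewrite (_ : _ - _ =
    (x ord0 j - ratr (q j)) - (y ord0 j - ratr (q j))); last first.
    by rewrite opprB addrA subrK.
  apply: (le_lt_trans (ler_normB _ _)).
  rewrite (splitr e); apply: ltrD; first exact: lt_trans (hq j) ke.
  by apply: lt_trans ke; have := yQ j; rewrite /Q mxE.
apply: bigcupT_measurable => n; rewrite /S; case: unpickle => // -[q k].
case: (pselect _) => ?; [exact: mbox|exact: measurable0].
Qed.

Lemma continuous_measurable_rV (f : 'rV[R]_d -> R) :
  continuous f -> measurable_fun [set: 'rV[R]_d] f.
Proof.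
move=> /continuousP cf; apply: (measurability _ (RGenOpens.measurableE R)).
move=> _ [_ [a [b ->] <-]]; rewrite setTI; apply: open_measurable_rV.
exact/cf/interval_open.
Qed.

End measurable_row_vectors.

(** * Euclidean norm and Taylor estimate *)

(** A nonnegative quadratic polynomial has nonpositive discriminant. This yields Cauchy-Schwarz both
    for [dotp] and for the form of the inverse information matrix. *)
Lemma discriminant_le (R : realFieldType) (a b c : R) :
  0 <= c -> (forall t, 0 <= a + 2 * t * b + t ^+ 2 * c) -> b ^+ 2 <= a * c.
Proof.
move=> c0 h; have [cz|cn] := eqVneq c 0.
  rewrite cz mulr0; have [->|bn] := eqVneq b 0; first by rewrite expr0n.
  (* At this [t] the affine function takes the value -1. *)
  have := h (- (a + 1) / (2 * b)); rewrite cz mulr0 addr0.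
  rewrite (_ : 2 * _ * b = - (a + 1)); last by field.
  by move=> ?; exfalso; lra.
have cp : 0 < c by rewrite lt0r cn.
have := h (- b / c).
rewrite (_ : _ + _ = (a * c - b ^+ 2) / c); last by field.
by rewrite pmulr_lge0 ?invr_gt0// subr_ge0.
Qed.

Section euclidean.
Context (R : realType) (d : nat).
Implicit Types (u v w : 'rV[R]_d) (A : 'M[R]_d).

Lemma dotpE u v : dotp u v = (u *m v^T) ord0 ord0.
Proof. by rewrite mxE; apply: eq_bigr => i _; rewrite mxE. Qed.

Lemma dotpC u v : dotp u v = dotp v u.
Proof. by apply: eq_bigr => i _; rewrite mulrC. Qed.

Lemma dotpDl u v w : dotp (u + v) w = dotp u w + dotp v w.
Proof. by rewrite !dotpE mulmxDl mxE. Qed.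

Lemma dotpZl k u v : dotp (k *: u) v = k * dotp u v.
Proof. by rewrite !dotpE -scalemxAl mxE. Qed.

Lemma dotpDr u v w : dotp w (u + v) = dotp w u + dotp w v.
Proof. by rewrite dotpC dotpDl !(dotpC w). Qed.

Lemma dotpZr k u v : dotp u (k *: v) = k * dotp u v.
Proof. by rewrite dotpC dotpZl dotpC. Qed.

Lemma dotpNl u v : dotp (- u) v = - dotp u v.
Proof. by rewrite -scaleN1r dotpZl mulN1r. Qed.

Lemma dotpNr u v : dotp u (- v) = - dotp u v.
Proof. by rewrite dotpC dotpNl dotpC. Qed.

Lemma dotpBl u v w : dotp (u - v) w = dotp u w - dotp v w.
Proof. by rewrite dotpDl dotpNl. Qed.

Lemma dotpp_ge0 v : 0 <= dotp v v.
Proof. by apply: sumr_ge0 => i _; rewrite -expr2 sqr_ge0. Qed.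

Lemma sqr_enorm v : enorm v ^+ 2 = dotp v v.
Proof. by rewrite sqr_sqrtr// dotpp_ge0. Qed.

Lemma enorm_ge0 v : 0 <= enorm v.
Proof. exact: sqrtr_ge0. Qed.

Lemma enorm0 : enorm (0 : 'rV[R]_d) = 0.
Proof. by rewrite /enorm dotpE mul0mx mxE sqrtr0. Qed.

Lemma enormZ k v : enorm (k *: v) = `|k| * enorm v.
Proof.
by rewrite /enorm dotpZl dotpZr mulrA -expr2 sqrtrM ?sqr_ge0// sqrtr_sqr.
Qed.

Lemma enormN v : enorm (- v) = enorm v.
Proof. by rewrite /enorm dotpNl dotpNr opprK. Qed.

Lemma dotp_sqr_le u v : dotp u v ^+ 2 <= dotp u u * dotp v v.
Proof.
apply: discriminant_le; first exact: dotpp_ge0.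
move=> t; have := dotpp_ge0 (u + t *: v).
by rewrite dotpDl !dotpDr !dotpZl !dotpZr (dotpC v u); lra.
Qed.

Lemma dotp_le_enorm u v : `|dotp u v| <= enorm u * enorm v.
Proof.
rewrite -(@ler_pXn2r _ 2)// ?nnegrE ?mulr_ge0 ?enorm_ge0//.
by rewrite real_normK ?num_real// exprMn !sqr_enorm; exact: dotp_sqr_le.
Qed.

Lemma enorm_gt0 v : v != 0 -> 0 < enorm v.
Proof.
move=> v0; rewrite sqrtr_gt0 lt0r dotpp_ge0 andbT; apply: contra_neq v0 => v0.
apply/rowP => i; rewrite mxE; apply/eqP; rewrite -sqrf_eq0 expr2.
by move: v0 => /eqP; rewrite psumr_eq0 => [/allP/(_ i)|j _]; [
  rewrite mem_index_enum => /(_ isT)|rewrite -expr2 sqr_ge0].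
Qed.

(** Cauchy-Schwarz on each column; the constant is the Frobenius norm. It shows that the set
    defining [opnorm] is bounded, so that its [sup] is a true supremum. *)
Lemma enorm_mulmx_le A v :
  enorm (v *m A) <= Num.sqrt (\sum_j dotp (\row_i A i j) (\row_i A i j)) * enorm v.
Proof.
rewrite -(@ler_pXn2r _ 2)// ?nnegrE ?mulr_ge0 ?enorm_ge0 ?sqrtr_ge0//.
rewrite exprMn !sqr_enorm sqr_sqrtr; last first.
  by apply: sumr_ge0 => j _; exact: dotpp_ge0.
rewrite mulr_suml /dotp; apply: ler_sum => j _; rewrite -expr2 mxE.
rewrite -/(dotp v v) (_ : \sum_i _ = dotp (\row_i A i j) v) ?dotp_sqr_le//.
by apply: eq_bigr => i _; rewrite mxE mulrC.
Qed.

Lemma enorm_mulmx_opnorm A v : enorm (v *m A) <= opnorm A * enorm v.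
Proof.
have [->|v0] := eqVneq v 0; first by rewrite mul0mx enorm0 mulr0.
have vp := enorm_gt0 v0.
rewrite -ler_pdivrMr//; apply: ub_le_sup.
  exists (Num.sqrt (\sum_j dotp (\row_i A i j) (\row_i A i j))) => _ [w /= w1 <-].
  apply: (le_trans (enorm_mulmx_le A w)).
  by rewrite ler_piMr ?sqrtr_ge0.
exists ((enorm v)^-1 *: v) => /=.
  by rewrite enormZ gtr0_norm ?invr_gt0// mulVf ?gt_eqF.
by rewrite -scalemxAl enormZ gtr0_norm ?invr_gt0// mulrC.
Qed.

End euclidean.

Section calculus_along_lines.
Context (R : realType) (d : nat).
Implicit Types (V : 'rV[R]_d -> R) (x v : 'rV[R]_d).

Lemma is_derive_line (W : normedModType R) (F : 'rV[R]_d -> W) x v t :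
  differentiable F (x + t *: v) ->
  is_derive t (1 : R) (fun t : R => F (x + t *: v)) ('D_v F (x + t *: v)).
Proof.
move=> dF.
have E : (fun h : R => h^-1 *:
      (((fun t : R => F (x + t *: v)) \o shift t) (h *: (1 : R)) -
       F (x + t *: v))) =
    (fun h : R => h^-1 *: ((F \o shift (x + t *: v)) (h *: v) - F (x + t *: v))).
  apply/funext => h /=; congr (_ *: (F _ - _)).
  by rewrite (_ : h *: (1 : R) = h); [rewrite scalerDl addrCA|exact: mulr1].
split; first by rewrite /derivable E; exact: diff_derivable.
by rewrite /derive E.
Qed.

Lemma derive_grad V x v : differentiable V x -> 'D_v V x = dotp (grad V x) v.
Proof.
move=> dV; rewrite deriveE// {1}(row_sum_delta v) linear_sum.
by apply: eq_bigr => i _; rewrite linearZ/= mxE deriveE// mulrC.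
Qed.

Lemma is_derive_grad_line V x v t : differentiable (grad V) (x + t *: v) ->
  is_derive t (1 : R) (fun t : R => dotp (grad V (x + t *: v)) v)
    (dotp (v *m hess V (x + t *: v)) v).
Proof.
move=> dg; have [ex dval] := is_derive_line dg.
pose g (i : 'I_d) (t : R) : R := v ord0 i *: grad V (x + t *: v) ord0 i.
have -> : (fun t : R => dotp (grad V (x + t *: v)) v) = \sum_i g i.
  by apply/funext => s; rewrite fct_sumE; apply: eq_bigr => i _; rewrite /g mulrC.
have -> : dotp (v *m hess V (x + t *: v)) v =
    \sum_i v ord0 i *: 'D_1 (fun t : R => grad V (x + t *: v) ord0 i) t.
  rewrite /hess -(deriveEjacobian v dg) -dval (derive_mx ex).
  by apply: eq_bigr => i _; rewrite mxE mulrC.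
apply: is_derive_sum => i.
apply: is_deriveZ.
by apply/derivableP; move/derivable_mxP : ex; exact.
Qed.

(** Two uses of the mean value theorem along the segment. They give [M] where Taylor's formula gives
    [M / 2], which is harmless: this second-order term vanishes in the limit of small steps. *)
Lemma taylor_grad_bound V M x v : (forall y, differentiable V y) ->
  (forall y, differentiable (grad V) y) ->
  (forall y, opnorm (hess V y) <= M) ->
  `|V (x + v) - V x - dotp (grad V x) v| <= M * enorm v ^+ 2.
Proof.
move=> dV dg hM.
have V01 : forall t : R, t \in `]0, 1[ ->
    is_derive t (1 : R) (fun t : R => V (x + t *: v))
      (dotp (grad V (x + t *: v)) v).
  by move=> t _; rewrite -derive_grad//; exact: is_derive_line.
have cV : {within `[0, 1], continuous (fun t : R => V (x + t *: v))}.
  apply: derivable_within_continuous => t _.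
  by have [] := is_derive_line (dV (x + t *: v)).
have [s /[!in_itv]/= /andP[s0 s1]] := MVT ltr01 V01 cV.
rewrite scale1r scale0r addr0 subr0 mulr1 => ->.
have g0s : forall t : R, t \in `]0, s[ ->
    is_derive t (1 : R) (fun t : R => dotp (grad V (x + t *: v)) v)
      (dotp (v *m hess V (x + t *: v)) v).
  by move=> t _; exact: is_derive_grad_line.
have cg : {within `[0, s], continuous (fun t : R => dotp (grad V (x + t *: v)) v)}.
  apply: derivable_within_continuous => t _.
  by have [] := is_derive_grad_line (dg (x + t *: v)).
have [r _] := MVT s0 g0s cg; rewrite scale0r addr0 subr0 => ->.
rewrite normrM (gtr0_norm s0).
apply: (@le_trans _ _ `|dotp (v *m hess V (x + r *: v)) v|).
  by rewrite ler_piMr// ltW.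
apply: (le_trans (dotp_le_enorm _ _)); rewrite expr2 mulrA ler_wpM2r ?enorm_ge0//.
by apply: (le_trans (enorm_mulmx_opnorm _ _)); rewrite ler_wpM2r ?enorm_ge0.
Qed.

End calculus_along_lines.

(** * Location families *)

(* With a = expR z and b = 1: the logarithmic mean (a - b) / (ln a - ln b) is at
   most (a + b) / 2, and ((a + b) / 2)^2 <= (a^2 + b^2) / 2. *)
Lemma expR_logmean (R : realType) (z : R) :
  (expR z - 1) ^+ 2 <= z ^+ 2 / 2 * (1 + expR z ^+ 2).
Proof.
(* The difference [k] of the two sides vanishes at 0, and its derivative [dk] is nonnegative because
   [1 - t <= expR (- t)]. *)
have pos (w : R) : 0 <= w -> 2 * (expR w - 1) <= w * (expR w + 1).
  rewrite le_eqVlt => /predU1P[<-|w0]; first by rewrite expR0; lra.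
  pose k (t : R) : R := t * (expR t + 1) - 2 * (expR t - 1).
  pose dk (t : R) : R := 1 - (1 - t) * expR t.
  have kd (t : R) : is_derive t (1 : R) k (dk t).
    have e1 : is_derive t (1 : R) (@expR R) (expR t) by exact: is_derive_expR.
    have i1 : is_derive t (1 : R) (@id R) 1 by exact: is_derive_id.
    have s1 := is_deriveD (is_deriveB (is_deriveD (is_deriveM i1 e1) i1)
      (is_deriveZ 2 e1)) (is_derive_cst (2 : R) t 1).
    have -> : k = (id * expR + id - 2 *: expR + cst 2).
      by apply/funext => x; rewrite /k !fctE /GRing.scale/=; ring.
    by apply: is_derive_eq s1 _; rewrite /dk /GRing.scale/=; ring.
  have kc : {within `[0, w], continuous k}.
    by apply: derivable_within_continuous => t _; have [] := kd t.
  have [c /[!in_itv]/= /andP[c0 _]] := MVT w0 (fun t _ => kd t) kc.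
  rewrite subr0 {1}/k {1}/k expR0 => E.
  suff : 0 <= dk c * w by rewrite -E; lra.
  rewrite mulr_ge0 ?(ltW w0)// /dk subr_ge0.
  rewrite -ler_pdivlMr ?expR_gt0// div1r -expRN.
  by have := expR_ge1Dx (- c); lra.
have abs : 4 * (expR z - 1) ^+ 2 <= z ^+ 2 * (expR z + 1) ^+ 2.
  have sq (a b : R) : 0 <= a -> a <= b -> a ^+ 2 <= b ^+ 2.
    by move=> a0 ab; rewrite ler_pXn2r// nnegrE; exact: le_trans ab.
  have [z0|z0] := leP 0 z.
    have e1 : 1 <= expR z by rewrite -expR0 ler_expR.
    by have := sq (2 * (expR z - 1)) _ ltac:(lra) (pos z z0); rewrite !exprMn; lra.
  (* Negative [z] reduces to [- z] after multiplication by [expR z]. *)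
  have h := pos (- z) ltac:(lra).
  have e1 : expR z <= 1 by rewrite -expR0 ler_expR ltW.
  have eN : expR (- z) * expR z = 1 by rewrite -expRD addNr expR0.
  have h2 : 2 * (1 - expR z) <= - z * (expR z + 1).
    have := ler_wpM2r (expR_ge0 z) h; nra.
  have := sq (2 * (1 - expR z)) _ ltac:(lra) h2; rewrite !exprMn; lra.
have z2 := sqr_ge0 z.
have e2 : (expR z + 1) ^+ 2 <= 2 * (1 + expR z ^+ 2).
  by have := sqr_ge0 (expR z - 1); lra.
have := ler_wpM2l z2 e2; nra.
Qed.

Section location_family.
Context (R : realType) (d : nat).
Variables (V : 'rV[R]_d -> R) (P : 'rV[R]_d -> probability 'rV[R]_d R) (M : R).
Hypothesis P_density : forall theta,
  has_density (P theta) (fun x => expR (- V (x - theta))).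
Hypothesis dV : forall x, differentiable V x.
Hypothesis dg : forall x, differentiable (grad V) x.
Hypothesis hM : forall x, opnorm (hess V x) <= M.

Lemma measurable_potential theta :
  measurable_fun [set: 'rV[R]_d] (fun x => V (x - theta)).
Proof.
have mV : measurable_fun [set: 'rV[R]_d] V.
  by apply: continuous_measurable_rV => x; exact: differentiable_continuous.
exact: measurableT_comp mV (measurable_translation_rV _).
Qed.

Lemma measurable_score i :
  measurable_fun [set: 'rV[R]_d] (fun x => grad V x ord0 i).
Proof.
apply: continuous_measurable_rV => x.
apply: (@continuous_comp _ _ _ (grad V) (fun y : 'rV[R]_d => y ord0 i)).
  exact: differentiable_continuous.
exact: coord_continuous.
Qed.

Lemma measurable_dotp_score v :
  measurable_fun [set: 'rV[R]_d] (fun x => dotp (grad V x) v).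
Proof.
apply: measurable_sum => i; apply: measurable_funM => //.
exact: measurable_score.
Qed.

Lemma integral_location theta (F : 'rV[R]_d -> \bar R) :
  (forall x, 0 <= F x)%E -> measurable_fun [set: 'rV[R]_d] F ->
  (\int[P theta]_x F x =
   \int[lebesgue_rV R d]_x (F x * (expR (- V (x - theta)))%:E))%E.
Proof.
move=> F0 mF.
have p0 x : 0 <= expR (- V (x - theta)) by exact: expR_ge0.
have mp : measurable_fun [set: 'rV[R]_d] (fun x => expR (- V (x - theta))).
  apply: measurableT_comp => //; apply: measurableT_comp => //.
  exact: measurable_potential.
exact: (ge0_integral_density p0 mp (P_density theta) F0 mF).
Qed.

Lemma integral_location_shift theta (F : 'rV[R]_d -> \bar R) :
  (forall x, 0 <= F x)%E -> measurable_fun [set: 'rV[R]_d] F ->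
  (\int[P theta]_x F (x - theta)%R = \int[P 0]_x F x)%E.
Proof.
move=> F0 mF.
have mFt : measurable_fun [set: 'rV[R]_d] (fun x => F (x - theta)).
  exact: measurableT_comp mF (measurable_translation_rV _).
rewrite [LHS](integral_location theta (fun x => F0 _) mFt).
rewrite [RHS](integral_location 0 F0 mF).
under [RHS]eq_integral do rewrite subr0.
rewrite -[RHS](ge0_integral_lebesgue_rV_translation (- theta))//.
- by move=> x; rewrite mule_ge0// lee_fin expR_ge0.
- apply: emeasurable_funM => //; apply/measurable_EFinP.
  apply: measurableT_comp => //; apply: measurableT_comp => //.
  by have := measurable_potential 0; under eq_fun do rewrite subr0.
Qed.

(** The square root of the density of [P theta'] relative to [P theta]. *)
Definition sqrt_ratio (theta theta' x : 'rV[R]_d) : R :=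
  expR ((V (x - theta) - V (x - theta')) / 2).

Lemma measurable_sqrt_ratio theta theta' :
  measurable_fun [set: 'rV[R]_d] (sqrt_ratio theta theta').
Proof.
apply: measurableT_comp => //; apply: measurable_funM => //.
by apply: measurable_funB; exact: measurable_potential.
Qed.

Lemma sqrt_ratio_ge0 theta theta' x : 0 <= sqrt_ratio theta theta' x.
Proof. exact: expR_ge0. Qed.

Lemma integral_sqrt_ratio theta theta' (F : 'rV[R]_d -> \bar R) :
  (forall x, 0 <= F x)%E -> measurable_fun [set: 'rV[R]_d] F ->
  (\int[P theta']_x F x =
   \int[P theta]_x (F x * (sqrt_ratio theta theta' x ^+ 2)%:E))%E.
Proof.
move=> F0 mF; have ms := measurable_sqrt_ratio theta theta'.
have Fs0 x : (0 <= F x * (sqrt_ratio theta theta' x ^+ 2)%:E)%E.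
  by rewrite mule_ge0// lee_fin sqr_ge0.
have mFs : measurable_fun [set: 'rV[R]_d]
    (fun x => F x * (sqrt_ratio theta theta' x ^+ 2)%:E)%E.
  by apply: emeasurable_funM => //; apply/measurable_EFinP; exact: measurable_funX.
rewrite [LHS](integral_location theta' F0 mF).
rewrite [RHS](integral_location theta Fs0 mFs).
apply: eq_integral => x _; rewrite -muleA -EFinM; congr (_ * _%:E)%E.
by rewrite /sqrt_ratio -expRM_natl -expRD; congr expR; field.
Qed.

(* The Hellinger integral is split symmetrically between P theta and
   P (theta + v), so that a gradient at the sampled point is available on both
   sides and the constant 1/4 is sharp as v tends to 0. *)
Lemma hellinger_location theta v :
  (\int[P 0]_x (dotp (grad V x) v ^+ 2)%:E < +oo ->
  \int[P theta]_x ((sqrt_ratio theta (theta + v) x - 1) ^+ 2)%:E <=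
    ((Num.sqrt (\int[P 0]_x (dotp (grad V x) v ^+ 2))%R + M * enorm v ^+ 2) ^+ 2
      / 4)%:E)%E.
Proof.
move=> Ioo; set I := (\int[P 0]_x _)%R; set C := M * enorm v ^+ 2.
pose X x := `|dotp (grad V x) v|.
pose D x := V (x - theta) - V (x - (theta + v)).
pose s := sqrt_ratio theta (theta + v).
have mX : measurable_fun [set: 'rV[R]_d] X.
  by apply: measurableT_comp => //; exact: measurable_dotp_score.
have mD : measurable_fun [set: 'rV[R]_d] D.
  by apply: measurable_funB; exact: measurable_potential.
have ms : measurable_fun [set: 'rV[R]_d] s by exact: measurable_sqrt_ratio.
have mD2 : measurable_fun [set: 'rV[R]_d] (fun x => D x ^+ 2).
  exact: measurable_funX.
have ms2 : measurable_fun [set: 'rV[R]_d] (fun x => s x ^+ 2).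
  exact: measurable_funX.
have mXC : measurable_fun [set: 'rV[R]_d] (fun x => (X x - - C) ^+ 2).
  exact: measurable_sqr_sub.
have P1 t : P t setT = 1%E by exact: probability_setT.
have X2E x : X x ^+ 2 = dotp (grad V x) v ^+ 2.
  by rewrite real_normK// num_real.
have X2oo : (\int[P 0]_x (X x ^+ 2)%:E < +oo)%E.
  by under eq_integral do rewrite X2E.
have IE : \int[P 0]_x (X x ^+ 2) = I by apply: eq_Rintegral => x _.
(* Minkowski's inequality for [X + C], obtained from the fact that the mean of [X] is at most
   [Num.sqrt I]. The form [X - - C] fits [second_momentE]. *)
have J : (\int[P 0]_x ((X x - - C) ^+ 2)%:E <= ((Num.sqrt I + C) ^+ 2)%:E)%E.
  rewrite (second_momentE (P1 0) mX X2oo) lee_fin.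
  have := sqr_mean_le (P1 0) mX X2oo; rewrite IE.
  set g := \int[P 0]_x X x => gI.
  have I0 : 0 <= I := le_trans (sqr_ge0 g) gI.
  have gs : g <= Num.sqrt I.
    by rewrite (le_trans (ler_norm g))// -sqrtr_sqr ler_wsqrtr.
  (* The sign of [C] comes from the Taylor bound, whose left-hand side is an absolute value. *)
  have C0 : 0 <= C := le_trans (normr_ge0 _) (taylor_grad_bound 0 v dV dg hM).
  by rewrite -[X in X - _](sqr_sqrtr I0); have := ler_wpM2l C0 gs; lra.
have D2 t : (forall x, `|D x| <= X (x - t) + C) ->
    (\int[P t]_x (D x ^+ 2)%:E <= ((Num.sqrt I + C) ^+ 2)%:E)%E.
  move=> hD; apply: le_trans J.
  rewrite -(integral_location_shift t
    (F := fun x => ((X x - - C) ^+ 2)%:E)); last 2 first.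
  - by move=> x; rewrite lee_fin sqr_ge0.
  - exact/measurable_EFinP.
  apply: (ge0_le_integral_EFin (P t) (f := fun x => D x ^+ 2)
    (g := fun x => (X (x - t) - - C) ^+ 2)).
  - by move=> x; exact: sqr_ge0.
  - exact: mD2.
  - exact: measurableT_comp mXC (measurable_translation_rV _).
  - move=> x; rewrite opprK -(real_normK (num_real (D x))).
    by rewrite ler_pXn2r ?nnegrE// (le_trans _ (hD x)).
(* This is [expR_logmean] at [z = D x / 2], where [expR z = s x]; hence the factor 1/8. The term
   weighted by [s x ^+ 2] is then an integral under [P (theta + v)]. *)
apply: (@le_trans _ _ (\int[P theta]_x
    (8^-1 * (D x ^+ 2 + D x ^+ 2 * s x ^+ 2))%:E)%E).
  apply: ge0_le_integral_EFin.
  - by move=> x; exact: sqr_ge0.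
  - exact: measurable_sqr_sub.
  - apply: measurable_funM => //; apply: measurable_funD => //.
    exact: measurable_funM.
  - move=> x; have := expR_logmean (D x / 2); rewrite /s /sqrt_ratio -/(D x); lra.
rewrite ge0_integralZ_EFin//; last 2 first.
- by move=> x; apply: addr_ge0; [exact: sqr_ge0|apply: mulr_ge0; exact: sqr_ge0].
- by apply: measurable_funD => //; exact: measurable_funM.
rewrite ge0_integralD_EFin//; last 3 first.
- by move=> x; exact: sqr_ge0.
- by move=> x; apply: mulr_ge0; exact: sqr_ge0.
- exact: measurable_funM.
have E : (\int[P theta]_x (D x ^+ 2 * s x ^+ 2)%:E =
    \int[P (theta + v)]_x (D x ^+ 2)%:E)%E.
  have D20 x : (0 <= (D x ^+ 2)%:E)%E by rewrite lee_fin sqr_ge0.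
  have mD2E : measurable_fun [set: 'rV[R]_d] (fun x => (D x ^+ 2)%:E).
    exact/measurable_EFinP.
  rewrite [RHS](integral_sqrt_ratio theta (theta + v) D20 mD2E).
  by apply: eq_integral => x _; rewrite EFinM.
rewrite E.
apply: (@le_trans _ _ ((8^-1)%:E *
  (((Num.sqrt I + C) ^+ 2)%:E + ((Num.sqrt I + C) ^+ 2)%:E))%E).
  rewrite lee_wpmul2l ?lee_fin//; apply: leeD; apply: D2 => x.
  - have := taylor_grad_bound (x - theta) (- v) dV dg hM.
    rewrite dotpNr enormN -/C /X /D opprD addrA => /ler_normlP[h1 h2].
    apply/ler_normlP.
    have /ler_normlP[h3 h4] := lexx `|dotp (grad V (x - theta)) v|.
    by split; lra.
  - have := taylor_grad_bound (x - (theta + v)) v dV dg hM.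
    have -> : x - (theta + v) + v = x - theta by rewrite opprD addrA subrK.
    rewrite -/C /X /D => /ler_normlP[h1 h2]; apply/ler_normlP.
    have /ler_normlP[h3 h4] := lexx `|dotp (grad V (x - (theta + v))) v|.
    by split; lra.
by rewrite -EFinD -EFinM lee_fin; lra.
Qed.

(* The entries of fisher_info are values of fine, which maps +oo to 0; the
   lower bound m > 0 on the diagonal excludes this junk value. *)
Lemma fisher_info_lty m i : 0 < m -> loewner_le m%:M (fisher_info (P 0) V) ->
  (\int[P 0]_x (grad V x ord0 i ^+ 2)%:E < +oo)%E.
Proof.
move=> m0 /(_ (delta_mx ord0 i)).
rewrite mulmxBr dotpBl subr_ge0 mul_mx_scalar -rowE.
rewrite dotpZl (_ : dotp _ _ = 1); last first.
  rewrite /dotp (bigD1 i)//= big1 ?addr0 => [|j ji]; rewrite !mxE ?eqxx ?mulr1//.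
  by rewrite (negbTE ji) mul0r.
rewrite mulr1 (_ : dotp _ _ = fisher_info (P 0) V i i); last first.
  rewrite /dotp (bigD1 i)//= big1 ?addr0 => [|j ji]; rewrite !mxE ?eqxx ?mulr1//.
  by rewrite (negbTE ji) mulr0.
rewrite mxE unlock => h; rewrite ltey; apply/negP => /eqP Ioo.
move: h; under eq_integral do rewrite -expr2.
by rewrite Ioo leNgt m0.
Qed.

(** Finite diagonal moments and [|a b| <= a^2 + b^2] make every entry a genuine integral, so the
    square can be expanded under the integral sign. *)
Lemma fisher_infoE m v : 0 < m -> loewner_le m%:M (fisher_info (P 0) V) ->
  (\int[P 0]_x (dotp (grad V x) v ^+ 2)%:E =
   (dotp (v *m fisher_info (P 0) V) v)%:E)%E.
Proof.
move=> m0 hI.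
have int i j : (P 0).-integrable setT
    (EFin \o (fun x => grad V x ord0 i * grad V x ord0 j)).
  have i2 k : (P 0).-integrable setT (EFin \o (fun x => grad V x ord0 k ^+ 2)).
    by apply: integrable_sqr; [exact: measurable_score|exact: fisher_info_lty hI].
  apply: (@le_integrable _ _ _ _ _ measurableT _
    ((EFin \o (fun x => grad V x ord0 i ^+ 2)) \+
     (EFin \o (fun x => grad V x ord0 j ^+ 2)))).
  - by apply/measurable_EFinP; apply: measurable_funM; exact: measurable_score.
  - move=> x _ /=; rewrite lee_fin [leRHS]ger0_norm ?addr_ge0 ?sqr_ge0//.
    set a := grad V x ord0 i; set b := grad V x ord0 j.
    by rewrite ler_norml; have := sqr_ge0 (a + b); have := sqr_ge0 (a - b); nra.
  - exact: (integrableD measurableT (i2 i) (i2 j)).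
have intZ i j : (P 0).-integrable setT (fun x =>
    (v ord0 i * v ord0 j)%:E * (grad V x ord0 i * grad V x ord0 j)%:E)%E.
  exact: (integrableZl measurableT _ (int i j)).
transitivity (\int[P 0]_x (\sum_i \sum_j
    (v ord0 i * v ord0 j)%:E * (grad V x ord0 i * grad V x ord0 j)%:E))%E.
  apply: eq_integral => x _; rewrite expr2 /dotp mulr_suml -sumEFin.
  apply: eq_bigr => i _; rewrite mulr_sumr -sumEFin.
  by apply: eq_bigr => j _; rewrite -EFinM; congr EFin; ring.
rewrite integral_sum//; last by move=> i; exact: integrable_sum.
rewrite /dotp -sumEFin.
transitivity (\sum_i \sum_j (v ord0 i * v ord0 j)%:E *
   (fisher_info (P 0) V i j)%:E)%E; last first.
  under eq_bigr do (under eq_bigr do rewrite -EFinM; rewrite sumEFin).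
  rewrite !sumEFin; congr EFin; rewrite exchange_big/=; apply: eq_bigr => j _.
  rewrite mxE mulr_suml; apply: eq_bigr => i _; ring.
apply: eq_bigr => i _; rewrite integral_sum//; apply: eq_bigr => j _.
rewrite (integralZl measurableT (int i j)) mxE unlock fineK//.
exact: (integrable_fin_num measurableT (int i j)).
Qed.

End location_family.

(** * Speed of the mean of an estimator along a segment *)

(** Here [h] is the step length, [k] the root of the information of the sample and [e] the
    second-order error. The slack between [(k + e)^2] and [(k + 1)^2] is at least 1/4, while
    [H (k + 1)^2 <= 1/4] for short steps, so this slack pays for the division by [1 - H]. *)
Lemma hellinger_step (R : realFieldType) (k h e r D H : R) :
  0 <= k -> 0 <= h -> 0 <= e -> e <= 1 / 2 -> 0 <= r ->
  h * (k + 1) ^+ 2 <= 1 -> H <= h ^+ 2 / 4 * (k + e) ^+ 2 ->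
  D ^+ 2 * (1 - H) <= 4 * H * r ^+ 2 -> `|D| <= h * r * (k + 1).
Proof.
move=> k0 h0 e0 e1 r0 hA HE hD.
set q := h ^+ 2 / 4 * (k + e) ^+ 2 in HE.
set A := (k + 1) ^+ 2 in hA.
have A1 : 1 <= A by rewrite /A; nra.
have h2 : 0 <= h ^+ 2 by exact: sqr_ge0.
have r2 : 0 <= r ^+ 2 by exact: sqr_ge0.
have D2 : 0 <= D ^+ 2 by exact: sqr_ge0.
have keA : (k + e) ^+ 2 <= A - 1 / 4 by rewrite /A; nra.
have ke0 : 0 <= (k + e) ^+ 2 by exact: sqr_ge0.
have h2A2 : h ^+ 2 * A ^+ 2 <= 1.
  by rewrite -exprMn exprn_ile1// mulr_ge0// (le_trans ler01).
have h2A : h ^+ 2 * A * A <= 1 by rewrite -mulrA -expr2.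
have h2A1 : h ^+ 2 * A <= 1.
  apply: le_trans h2A; rewrite ler_peMr// mulr_ge0// (le_trans ler01)//.
have qA : q <= h ^+ 2 / 4 * A.
  by rewrite /q ler_wpM2l ?divr_ge0//; lra.
have q1 : q <= 1 / 4 by lra.
have qAA : q * A <= 1 / 4.
  have := ler_wpM2r (le_trans ler01 A1) qA; lra.
have hDq : D ^+ 2 * (1 - q) <= 4 * q * r ^+ 2.
  have := ler_wpM2l D2 HE; have := ler_wpM2l r2 HE; lra.
have hrk : 0 <= h * r * (k + 1) by rewrite !mulr_ge0// addr_ge0.
rewrite -(@ler_pXn2r _ 2)// ?nnegrE// real_normK ?num_real//.
rewrite !exprMn -/A leNgt; apply/negP => lt.
have q1p : 0 < 1 - q by lra.
have := lt_le_trans (_ : h ^+ 2 * r ^+ 2 * A * (1 - q) < _) hDq.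
rewrite ltr_pM2r// => /(_ lt).
have -> : 4 * q * r ^+ 2 = h ^+ 2 * r ^+ 2 * (k + e) ^+ 2 by rewrite /q; field.
rewrite -mulrA ltNge ler_wpM2l// ?mulr_ge0//; lra.
Qed.

Section displacement.
Context (R : realType) (d n : nat).
Variables (V : 'rV[R]_d -> R) (P : 'rV[R]_d -> probability 'rV[R]_d R) (M m : R).
Hypothesis P_density : forall theta,
  has_density (P theta) (fun x => expR (- V (x - theta))).
Hypothesis dV : forall x, differentiable V x.
Hypothesis dg : forall x, differentiable (grad V) x.
Hypothesis hM : forall x, opnorm (hess V x) <= M.
Hypothesis m0 : 0 < m.
Hypothesis hI : loewner_le m%:M (fisher_info (P 0) V).
Variables (T : n.-tuple 'rV[R]_d -> R) (r : R).
Hypotheses (mT : measurable_fun [set: n.-tuple 'rV[R]_d] T) (r0 : 0 <= r).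

Let I := fisher_info (P 0) V.
Let mean theta := (\int[tuple_measure (P theta) n]_X T X)%R.
(** The centre may vary with [theta]: the speed of the mean depends on the risk only through the
    variance. *)
Let risk_le theta := exists a,
  (\int[tuple_measure (P theta) n]_X ((T X - a) ^+ 2)%:E <= (r ^+ 2)%:E)%E.

Lemma mean_diff_step theta v : risk_le theta -> risk_le (theta + v) ->
  (mean (theta + v) - mean theta) ^+ 2 *
    (1 - n%:R * ((Num.sqrt (dotp (v *m I) v) + M * enorm v ^+ 2) ^+ 2 / 4)) <=
  4 * (n%:R * ((Num.sqrt (dotp (v *m I) v) + M * enorm v ^+ 2) ^+ 2 / 4)) * r ^+ 2.
Proof.
move=> [a0 ra0] [a1 ra1].
have IE := fisher_infoE dg v m0 hI.
have Ioo : (\int[P 0]_x (dotp (grad V x) v ^+ 2)%:E < +oo)%E by rewrite IE ltry.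
have := hellinger_location P_density dV dg hM theta Ioo.
rewrite /Rintegral IE [fine _]/= => H1.
have ms := measurable_sqrt_ratio dV theta (theta + v).
have P1 t : P t setT = 1%E by exact: probability_setT.
have PE F := @integral_sqrt_ratio _ _ V P P_density dV theta (theta + v) F.
have Hn := hellinger_tuple_measure n (P1 theta) (P1 (theta + v)) ms
  (sqrt_ratio_ge0 V theta (theta + v)) PE H1.
have PnE F :=
  @ge0_integral_tuple_density _ _ _ (P theta) (P (theta + v)) _ n ms PE F.
exact: (mean_diff_hellinger (tuple_measure_setT n (P1 theta))
  (tuple_measure_setT n (P1 (theta + v))) (measurable_tprod ms) mT PnE Hn ra0 ra1).
Qed.

(** One step moves the mean by at most [h r (k + 1)], and the [N] steps have total length
    [N h = 2]. *)
Lemma mean_displacement theta u :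
  (forall t, -1 <= t -> t <= 1 -> risk_le (theta + t *: u)) ->
  `|mean (theta + u) - mean (theta - u)| <=
  2 * r * (Num.sqrt (n%:R * dotp (u *m I) u) + 1).
Proof.
move=> hrisk; set k := Num.sqrt (n%:R * dotp (u *m I) u).
have k0 : 0 <= k by exact: sqrtr_ge0.
have I0 v : 0 <= dotp (v *m I) v.
  have := hI v; rewrite mulmxBr dotpBl subr_ge0; apply: le_trans.
  by rewrite mul_mx_scalar dotpZl mulr_ge0 ?dotpp_ge0// ltW.
pose C := Num.sqrt n%:R * (M * enorm u ^+ 2).
have C0 : 0 <= C.
  rewrite mulr_ge0 ?sqrtr_ge0//.
  exact: le_trans (normr_ge0 _) (taylor_grad_bound 0 u dV dg hM).
(* The segment is cut into N steps, short enough for hellinger_step. *)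
pose N := (Num.bound (4 * C + 2 * (k + 1) ^+ 2)).+1.
have hN : 4 * C + 2 * (k + 1) ^+ 2 <= N%:R.
  have p0 : 0 <= 4 * C + 2 * (k + 1) ^+ 2.
    by rewrite addr_ge0// mulr_ge0// sqr_ge0.
  by rewrite (le_trans (ltW (archi_boundP p0)))// ler_nat.
have N0 : 0 < N%:R :> R by rewrite ltr0n.
pose h : R := 2 / N%:R.
have h0 : 0 <= h by rewrite divr_ge0.
have hC : h * C <= 1 / 2.
  rewrite /h mulrAC ler_pdivrMr//; have := sqr_ge0 (k + 1); lra.
have hk : h * (k + 1) ^+ 2 <= 1.
  by rewrite /h mulrAC ler_pdivrMr//; lra.
(* The chain runs from [theta - u] at [i = 0] to [theta + u] at [i = N]. *)
pose z (i : nat) := theta + (-1 + i%:R * h) *: u.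
have zS i : z i.+1 = z i + h *: u.
  by rewrite /z -addrA -scalerDl -natr1 mulrDl mul1r addrA.
have zr i : (i <= N)%N -> risk_le (z i).
  move=> iN; apply: hrisk; first by rewrite lerDl mulr_ge0.
  rewrite -lerBrDl opprK /h mulrA ler_pdivrMr// -[1 + 1]/(2 : R) mulrC.
  by rewrite ler_wpM2l// ler_nat.
have step i : (i < N)%N -> `|mean (z i.+1) - mean (z i)| <= h * r * (k + 1).
  move=> iN; rewrite zS.
  have r1 := zr i (ltnW iN); have r2 := zr i.+1 iN; rewrite zS in r2.
  (* The error is [e = h C]: for [v = h *: u], the root of [n] times the bracket in [mean_diff_step]
     is [h (k + h C)]. *)
  apply: (hellinger_step k0 h0 _ hC r0 hk _ (mean_diff_step r1 r2)).
    exact: mulr_ge0.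
  have -> : dotp (h *: u *m I) (h *: u) = h ^+ 2 * dotp (u *m I) u.
    by rewrite -scalemxAl dotpZl dotpZr mulrA expr2.
  rewrite (sqrtrM _ (sqr_ge0 h)) sqrtr_sqr.
  rewrite enormZ (ger0_norm h0) /k sqrtrM// /C.
  set sn := Num.sqrt n%:R; set sI := Num.sqrt (dotp (u *m I) u).
  rewrite -[n%:R](@sqr_sqrtr _ n%:R)// -/sn.
  by rewrite le_eqVlt; apply/orP; left; apply/eqP; field.
have tele j : (j <= N)%N ->
    `|mean (z j) - mean (z 0%N)| <= j%:R * (h * r * (k + 1)).
  elim: j => [|j IH] jN; first by rewrite subrr normr0 mul0r.
  rewrite -(subrKA (mean (z j))) (le_trans (ler_normD _ _))//.
  rewrite -[j.+1%:R]natr1 [leRHS]mulrDl mul1r [leRHS]addrC.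
  by apply: lerD; [exact: step|apply: IH; exact: ltnW].
have := tele N (leqnn N).
have Nh : N%:R * h = 2 by rewrite /h mulrC divfK// gt_eqF.
rewrite /z mul0r addr0 scaleN1r Nh (_ : -1 + 2 = 1); last by lra.
by rewrite scale1r (mulrA N%:R) (mulrA N%:R) Nh.
Qed.

End displacement.

(** * From normalized risk to quadratic risk *)

Section risk.
Context (R : realType) (d n : nat).
Variables (Q : probability 'rV[R]_d R) (T : n.-tuple 'rV[R]_d -> R).
Hypotheses (n0 : (0 < n)%N) (mT : measurable_fun [set: n.-tuple 'rV[R]_d] T).

Lemma normalized_risk_ge0 s a : 0 <= s -> (0 <= normalized_risk Q s a T)%E.
Proof.
move=> s0; rewrite /normalized_risk mule_ge0 ?inve_ge0 ?lee_fin//.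
by rewrite mule_ge0 ?lee_fin ?sqrtr_ge0// Lnorm_ge0.
Qed.

(** An infinite integral would make the normalized risk infinite, against the real bound [b]; a
    finite one is obtained by solving for it. *)
Lemma normalized_risk_le s a b : 0 < s -> (normalized_risk Q s a T <= b%:E)%E ->
  (\int[tuple_measure Q n]_X ((T X - a) ^+ 2)%:E <=
    ((b * s / Num.sqrt n%:R) ^+ 2)%:E)%E.
Proof.
move=> s0; rewrite /normalized_risk unlock /=.
have -> : (\int[tuple_measure Q n]_X (`|(T X - a)%:E| `^ 2) =
    \int[tuple_measure Q n]_X ((T X - a) ^+ 2)%:E)%E.
  apply: eq_integral => X _; rewrite [LHS]poweR_EFin.
  by rewrite (powR_mulrn 2 (normr_ge0 _)) real_normK ?num_real.
set J := integral _ _ _.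
have J0 : (0 <= J)%E by apply: integral_ge0 => X _; rewrite lee_fin sqr_ge0.
have sn : 0 < Num.sqrt n%:R :> R by rewrite sqrtr_gt0 ltr0n.
rewrite inver gt_eqF//.
move: J0; case: J => [j|_|//]; last first.
  by rewrite poweRyr// gt0_muley ?lte_fin// gt0_mulye ?lte_fin ?invr_gt0// leye_eq.
move=> j0'; have j0 : 0 <= j by rewrite -lee_fin.
rewrite poweR_EFin powR12_sqrt// -!EFinM lee_fin.
rewrite ler_pdivrMr// => h.
have h2 : Num.sqrt j <= b * s / Num.sqrt n%:R by rewrite ler_pdivlMr// mulrC.
rewrite lee_fin -{1}(sqr_sqrtr j0) ler_pXn2r// ?nnegrE ?sqrtr_ge0//.
by rewrite (le_trans _ h2)// sqrtr_ge0.
Qed.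

End risk.

(** * The norm of the inverse information matrix *)

Section inverse_information.
Context (R : realType) (d : nat).
Variables (I : 'M[R]_d) (m : R).
Hypotheses (m0 : 0 < m) (I_sym : I^T = I) (hI : loewner_le m%:M I).
Implicit Types v w : 'rV[R]_d.

Let J := invmx I.

Lemma loewner_le_quadratic v : m * enorm v ^+ 2 <= dotp (v *m I) v.
Proof.
have := hI v; rewrite mulmxBr dotpBl subr_ge0 mul_mx_scalar dotpZl.
by rewrite sqr_enorm.
Qed.

Lemma loewner_le_unitmx : I \in unitmx.
Proof.
rewrite -row_free_unit; apply/inj_row_free => v vI.
apply/eqP/negPn/negP => v0; have := loewner_le_quadratic v.
rewrite vI dotpE mul0mx mxE leNgt mulr_gt0// exprn_gt0//.
exact: enorm_gt0.
Qed.

Lemma mulmx_invK v : v *m J *m I = v.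
Proof. by rewrite mulmxKV// loewner_le_unitmx. Qed.

Lemma dotp_inv_sym v w : dotp (v *m J) w = dotp (w *m J) v.
Proof.
by rewrite [LHS]dotpC !dotpE trmx_mul mulmxA /J trmx_inv I_sym.
Qed.

Lemma dotp_inv_ge v : m * enorm (v *m J) ^+ 2 <= dotp (v *m J) v.
Proof.
by have := loewner_le_quadratic (v *m J); rewrite mulmx_invK dotpC.
Qed.

Lemma dotp_inv_ge0 v : 0 <= dotp (v *m J) v.
Proof. by rewrite (le_trans _ (dotp_inv_ge v))// mulr_ge0 ?sqr_ge0// ltW. Qed.

(** No spectral theory: with [w = enorm (v *m J)], one has [m w^2 <= q <= w |v|], hence [m w <= |v|]
    and [m q <= |v|^2]. *)
Lemma sqrt_dotp_inv_le v : Num.sqrt (dotp (v *m J) v) <= enorm v / Num.sqrt m.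
Proof.
set q := dotp (v *m J) v; set w := enorm (v *m J).
have q0 : 0 <= q by exact: dotp_inv_ge0.
have sm : 0 < Num.sqrt m by rewrite sqrtr_gt0.
have h1 : m * w ^+ 2 <= q by exact: dotp_inv_ge.
have h2 : q <= w * enorm v by rewrite (le_trans (ler_norm _))// dotp_le_enorm.
have w0 : 0 <= w by exact: enorm_ge0.
have v0 : 0 <= enorm v by exact: enorm_ge0.
have mw : m * w <= enorm v.
  have [->|wn] := eqVneq w 0; first by rewrite mulr0.
  have wp : 0 < w by rewrite lt0r wn.
  by rewrite -(ler_pM2r wp) -mulrA -expr2 (le_trans h1)// mulrC.
rewrite ler_pdivlMr// -(@ler_pXn2r _ 2)// ?nnegrE ?mulr_ge0 ?sqrtr_ge0//.
rewrite exprMn (sqr_sqrtr q0) (sqr_sqrtr (ltW m0)).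
rewrite (le_trans (_ : _ <= (w * enorm v) * m)) ?ler_wpM2r ?(ltW m0)//.
by rewrite mulrAC expr2 ler_wpM2r// mulrC.
Qed.

(** Cauchy-Schwarz for the symmetric nonnegative form of [J]. It controls how [sigma_f] varies with
    the gradient. *)
Lemma sqrt_dotp_inv_triangle v w : Num.sqrt (dotp ((v + w) *m J) (v + w)) <=
  Num.sqrt (dotp (v *m J) v) + Num.sqrt (dotp (w *m J) w).
Proof.
have q0 := dotp_inv_ge0.
have cs : dotp (v *m J) w ^+ 2 <= dotp (v *m J) v * dotp (w *m J) w.
  apply: discriminant_le => [|t]; first exact: q0.
  have := q0 (v + t *: w).
  rewrite mulmxDl -scalemxAl dotpDl !dotpDr !dotpZl !dotpZr (dotp_inv_sym w v).
  by lra.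
have cs' : dotp (v *m J) w <=
    Num.sqrt (dotp (v *m J) v) * Num.sqrt (dotp (w *m J) w).
  by rewrite (le_trans (ler_norm _))// -sqrtr_sqr -sqrtrM// ler_wsqrtr.
rewrite -(@ler_pXn2r _ 2)// ?nnegrE ?addr_ge0 ?sqrtr_ge0//.
rewrite sqrrD !sqr_sqrtr// mulmxDl dotpDl !dotpDr (dotp_inv_sym w v).
by rewrite -mulr_natl; lra.
Qed.

End inverse_information.

Lemma fisher_info_sym (R : realType) d (P : probability 'rV[R]_d R) V :
  (fisher_info P V)^T = fisher_info P V.
Proof.
apply/matrixP => i j; rewrite !mxE; congr (fine (expectation _ _)).
by apply/funext => x; rewrite mulrC.
Qed.

(** * Smoothness of the functional *)

Section holder.
Context (R : realType) (d : nat).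
Variables (f : 'rV[R]_d -> R) (rho : R).
Hypotheses (rho0 : 0 < rho) (f_holder : C1_holder rho f).

Let F := fine (C1_holder_norm rho f).

Lemma C1_holder_norm_ge0 : (0 <= C1_holder_norm rho f)%E.
Proof.
rewrite /C1_holder_norm !le_max; apply/orP; left; apply/orP; left.
apply: (@le_trans _ _ (`|f 0|)%:E); first by rewrite lee_fin.
by apply: ereal_sup_ubound; exists 0.
Qed.

Lemma C1_holder_normE : C1_holder_norm rho f = F%:E.
Proof. by rewrite fineK// ge0_fin_numE ?C1_holder_norm_ge0//; case: f_holder. Qed.

Lemma C1_holder_grad_le (x y : 'rV[R]_d) :
  enorm (grad f x - grad f y) <= F * enorm (x - y) `^ rho.
Proof.
have [->|xy] := eqVneq x y.
  by rewrite !subrr enorm0 powR0 ?mulr0// gt_eqF.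
have e0 : 0 < enorm (x - y) by rewrite enorm_gt0// subr_eq0.
rewrite -ler_pdivrMr ?powR_gt0// -lee_fin -C1_holder_normE.
rewrite /C1_holder_norm le_max; apply/orP; right.
by apply: ereal_sup_ubound; exists (x, y).
Qed.

(** By the mean value theorem the increment is twice the derivative at an intermediate point;
    Cauchy-Schwarz compares that gradient with the one at [x]. *)
Lemma line_increment_ge x u B :
  (forall t, -1 <= t -> t <= 1 -> enorm (grad f (x + t *: u) - grad f x) <= B) ->
  2 * (dotp (grad f x) u - B * enorm u) <= f (x + u) - f (x - u).
Proof.
move=> hB; have [df _] := f_holder.
have kd (t : R) : is_derive t (1 : R) (fun t : R => f (x + t *: u))
    (dotp (grad f (x + t *: u)) u).
  by rewrite -derive_grad//; exact: is_derive_line.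
have kc : {within `[-1, 1], continuous (fun t : R => f (x + t *: u))}.
  by apply: derivable_within_continuous => t _; have [] := kd t.
have lt11 : (-1 : R) < 1 by lra.
have [t /[!in_itv]/= /andP[t0 t1]] := MVT lt11 (fun t _ => kd t) kc.
rewrite scale1r scaleN1r => ->.
have := dotp_le_enorm (grad f (x + t *: u) - grad f x) u.
rewrite dotpBl => /ler_normlP[+ _].
have := ler_wpM2r (enorm_ge0 u) (hB t (ltW t0) (ltW t1)).
by lra.
Qed.

End holder.

(** * The minimax lower bound *)

(** If [s < 1 - x - 2 b], then [s (1 + b) (k + 2)] is less than [(1 - b) (1 - x) (k + 2)], which is
    at most [(1 - b) k] because [2 <= x k]: a contradiction. *)
Lemma bias_variance_algebra (R : realType) (s b k x : R) :
  0 <= s -> 0 <= b -> 0 < k -> 2 <= x * k ->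
  k * (1 - b) <= s * (1 + b) * (k + 2) -> 1 - x - 2 * b <= s.
Proof.
move=> s0 b0 k0 xk h; rewrite leNgt; apply/negP => sl.
have x0 : 0 < x by rewrite -(pmulr_lgt0 _ k0); lra.
have bk : 0 < (1 + b) * (k + 2) by rewrite mulr_gt0//; lra.
have := le_lt_trans h (_ : _ < (1 - x - 2 * b) * ((1 + b) * (k + 2))).
rewrite -mulrA ltr_pM2r// => /(_ sl).
have bx : 0 <= b * x by rewrite mulr_ge0// ltW.
have e1 : (1 - x - 2 * b) * (1 + b) <= (1 - b) * (1 - x) by nra.
have k2 : 0 <= k + 2 by lra.
have b1 : 0 <= 1 - b by lra.
have := ler_wpM2r k2 e1.
have e2 : (1 - x) * (k + 2) <= k by nra.
have := ler_wpM2l b1 e2; nra.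
Qed.

(** The nondegeneracy condition excludes the quotient 0/0, which [\bar R] reads as 0. For [f = 0]
    the estimator 0 would then have normalized risk 0, while the bound is positive for large [c]. *)
Theorem proposition2p3 (R : realType) (n d : nat)
    (n_ge1 : (1 <= n)%N) (d_ge1 : (1 <= d)%N)
    (V : 'rV[R]_d -> R)
    (V_convex : convex_function [set: convex_lmodType 'rV[R]_d] V)
    (V_norm : (\int[lebesgue_rV R d]_x (expR (- V x))%:E = 1)%E)
    (P : 'rV[R]_d -> probability 'rV[R]_d R)
    (P_density : forall theta,
      has_density (P theta) (fun x => expR (- V (x - theta))))
    (M L m : R) (M_gt0 : 0 < M) (L_gt0 : 0 < L) (m_gt0 : 0 < m)
    (V_assumption1 : assumption1 (P 0) V M L m)
    (rho : R) (rho_gt0 : 0 < rho) (rho_le1 : rho <= 1)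
    (f : 'rV[R]_d -> R) (f_holder : C1_holder rho f) :
  let sigma := sigma_f (fisher_info (P 0) V) f in
  forall (c : R) (theta0 : 'rV[R]_d), 0 < c ->
  ~ (C1_holder_norm rho f = 0%E /\ sigma theta0 = 0) ->
  ((1 - 3 * pi / (Num.sqrt (8 * m) * c))%:E
    - (2 / Num.sqrt m)%:E * (C1_holder_norm rho f / (sigma theta0)%:E)
      * ((c / Num.sqrt n%:R) `^ rho)%:E
   <= ereal_inf
        [set ereal_sup
               [set normalized_risk (P theta) (sigma theta) (f theta) T
               | theta in [set theta | enorm (theta - theta0)
                                       <= c / Num.sqrt n%:R]%R]
        | T in estimators R d n])%E.
Proof.
move=> sigma c theta0 c0 nondegenerate.
have [_ [dV dg _] hM0 _ hI] := V_assumption1.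
have hM x : opnorm (hess V x) <= M.
  by rewrite -lee_fin (le_trans _ hM0)//; apply: ereal_sup_ubound; exists x.
pose I := fisher_info (P 0) V; rewrite -/I in hI.
have I_sym : I^T = I by exact: fisher_info_sym.
set F := fine (C1_holder_norm rho f).
have FE : C1_holder_norm rho f = F%:E by exact: C1_holder_normE.
have F0 : 0 <= F by rewrite fine_ge0// C1_holder_norm_ge0.
set sn := Num.sqrt n%:R.
have sn0 : 0 < sn by rewrite sqrtr_gt0 ltr0n.
set delta := c / sn.
have delta0 : 0 < delta by rewrite divr_gt0.
set mu := Num.sqrt m.
have mu0 : 0 < mu by rewrite sqrtr_gt0.
apply: le_ereal_inf_tmp => _ [T mT <-]; set S := ereal_sup _.
have sigma0 theta : 0 <= sigma theta by exact: sqrtr_ge0.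
have S_ub theta : enorm (theta - theta0) <= delta ->
    (normalized_risk (P theta) (sigma theta) (f theta) T <= S)%E.
  by move=> h; apply: ereal_sup_ubound; exists theta.
have S0 : (0 <= S)%E.
  apply: le_trans (S_ub theta0 _); first exact: normalized_risk_ge0.
  by rewrite subrr enorm0 ltW.
(* If [sigma theta0] vanishes, the Holder norm is positive, its quotient by 0 is [+oo] and the bound
   to prove is [-oo]. *)
have [sz|snz] := eqVneq (sigma theta0) 0.
  have Fp : 0 < F.
    rewrite lt0r F0 andbT; apply/eqP => Fz; apply: nondegenerate.
    by rewrite FE Fz.
  rewrite FE sz inve0 gt0_muley ?lte_fin// gt0_muley ?lte_fin ?divr_gt0//.
  by rewrite gt0_mulye ?lte_fin ?powR_gt0// addeNy leNye.
have s0p : 0 < sigma theta0 by rewrite lt0r snz sigma0.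
set s0 := sigma theta0 in snz s0p *.
rewrite FE inver (negbTE snz) -!EFinM -EFinB.
case: S S0 S_ub => [s|_ _|//]; last by rewrite leey.
rewrite !lee_fin => s_ge0 S_ub.
set x := 3 * pi / (Num.sqrt (8 * m) * c).
(* [B] bounds the oscillation of the gradient on the ball, and [b] the relative oscillation of
   [sigma]. *)
set B := F * delta `^ rho; pose b := B / (mu * s0).
have B0 : 0 <= B by rewrite mulr_ge0// powR_ge0.
have b0 : 0 <= b by rewrite divr_ge0// mulr_ge0// ltW.
have -> : 2 / mu * (F / s0) * delta `^ rho = 2 * b.
  by rewrite /b /B; field; rewrite snz gt_eqF.
(* A nonpositive bound is trivial. Otherwise [b < 1/2], which keeps [sigma] positive on the whole
   ball. *)
have [neg|pos] := leP (1 - x - 2 * b) 0; first exact: le_trans s_ge0.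
have x0 : 0 <= x.
  by rewrite divr_ge0 ?mulr_ge0 ?pi_ge0 ?sqrtr_ge0// ltW.
have Bmu : B / mu = b * s0 by rewrite /b; field; rewrite snz gt_eqF.
have grad_le theta : enorm (theta - theta0) <= delta ->
    enorm (grad f theta - grad f theta0) <= B.
  move=> h; apply: (le_trans (C1_holder_grad_le rho_gt0 f_holder _ _)).
  rewrite ler_wpM2l// ge0_ler_powR ?nnegrE ?enorm_ge0//; exact: ltW.
have sqrt_le theta : enorm (theta - theta0) <= delta ->
    Num.sqrt (dotp ((grad f theta - grad f theta0) *m invmx I)
      (grad f theta - grad f theta0)) <= b * s0.
  move=> h; apply: (le_trans (sqrt_dotp_inv_le m_gt0 hI _)).
  by rewrite -Bmu ler_wpM2r ?invr_ge0 ?(ltW mu0)// grad_le.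
have sigma_le theta : enorm (theta - theta0) <= delta -> sigma theta <= s0 + b * s0.
  move=> h; apply: le_trans (lerD (lexx s0) (sqrt_le _ h)).
  have := sqrt_dotp_inv_triangle m_gt0 I_sym hI (grad f theta0)
    (grad f theta - grad f theta0).
  by rewrite addrC subrK.
have sigma_gt0 theta : enorm (theta - theta0) <= delta -> 0 < sigma theta.
  move=> h; have := sqrt_dotp_inv_triangle m_gt0 I_sym hI (grad f theta)
    (grad f theta0 - grad f theta).
  rewrite addrC subrK -/(sigma_f I f theta0) -/(sigma_f I f theta) -/(sigma theta)
    -/(sigma theta0) -/s0.
  rewrite -opprB mulNmx dotpNl dotpNr opprK.
  move=> /le_trans/(_ (lerD (lexx _) (sqrt_le _ h))).
  have : b * s0 < s0 by rewrite gtr_pMl//; lra.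
  by move: (sigma theta) => ?; lra.
(* A bound for the root of the quadratic risk, uniform over the ball, since
   [sigma theta <= s0 + b * s0] there. *)
pose r := s * (s0 + b * s0) / sn.
have r0 : 0 <= r.
  have bs0 : 0 <= b * s0 by rewrite mulr_ge0// ltW.
  by rewrite divr_ge0 ?(ltW sn0)// mulr_ge0// addr_ge0// ltW.
have risk theta : enorm (theta - theta0) <= delta ->
    (\int[tuple_measure (P theta) n]_X ((T X - f theta) ^+ 2)%:E <= (r ^+ 2)%:E)%E.
  move=> h; apply: (le_trans (normalized_risk_le n_ge1 (sigma_gt0 _ h) (S_ub _ h))).
  have nn : 0 <= s * sigma theta / sn.
    exact: divr_ge0 (mulr_ge0 s_ge0 (sigma0 theta)) (ltW sn0).
  rewrite lee_fin ler_pXn2r ?nnegrE//.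
  by rewrite /r ler_wpM2r ?invr_ge0 ?(ltW sn0)// ler_wpM2l// sigma_le.
(* The least favourable direction: its product with the gradient and its Fisher information both
   equal [s0 ^+ 2]. *)
pose h := grad f theta0 *m invmx I.
have hg : dotp h (grad f theta0) = s0 ^+ 2.
  by rewrite sqr_sqrtr// (dotp_inv_ge0 m_gt0 hI).
have hIh : dotp (h *m I) h = s0 ^+ 2 by rewrite (mulmx_invK m_gt0 hI) dotpC.
have h0 : h != 0.
  apply/eqP => hz; move: hg; rewrite hz dotpE mul0mx mxE => /esym/eqP.
  by rewrite sqrf_eq0 (negbTE snz).
have eh : 0 < enorm h by exact: enorm_gt0.
pose u := (delta / enorm h) *: h.
have eu : enorm u = delta.
  by rewrite enormZ ger0_norm ?divr_ge0 ?ltW// divfK// gt_eqF.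
have ball t : -1 <= t -> t <= 1 -> enorm (theta0 + t *: u - theta0) <= delta.
  move=> t0 t1; rewrite addrAC subrr add0r enormZ eu ler_piMl ?(ltW delta0)//.
  by rewrite ler_norml t0.
pose k := c * s0 / enorm h.
have k0 : 0 < k by rewrite divr_gt0// mulr_gt0.
(* This amounts to [m |h|^2 <= <I h, h> = s0^2]. *)
have kmu : c * mu <= k.
  rewrite /k ler_pdivlMr// -mulrA ler_wpM2l ?(ltW c0)//.
  rewrite -(@ler_pXn2r _ 2)// ?nnegrE ?(ltW s0p) ?mulr_ge0 ?(ltW mu0) ?enorm_ge0//.
  rewrite exprMn (sqr_sqrtr (ltW m_gt0)) -hIh.
  exact: loewner_le_quadratic.
have nd : sn ^+ 2 = n%:R by rewrite sqr_sqrtr.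
have kE : Num.sqrt (n%:R * dotp (u *m I) u) = k.
  rewrite -scalemxAl dotpZl dotpZr hIh -nd.
  rewrite (_ : _ * _ = k ^+ 2) ?sqrtr_sqr ?ger0_norm ?(ltW k0)//.
  by rewrite /k /delta; field; rewrite !gt_eqF.
have risk_line t : -1 <= t -> t <= 1 -> exists a,
    (\int[tuple_measure (P (theta0 + t *: u)%R) n]_X ((T X - a) ^+ 2)%:E
      <= (r ^+ 2)%:E)%E.
  by move=> t0 t1; exists (f (theta0 + t *: u)); apply/risk/ball.
have := mean_displacement P_density dV dg hM m_gt0 hI mT r0 risk_line.
rewrite kE; set gp := Rintegral _ _ _; set gm := Rintegral _ _ _ => disp.
have PT theta : tuple_measure (P theta) n setT = 1%E.
  exact/tuple_measure_setT/probability_setT.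
have lt11 : (-1 : R) <= 1 by rewrite (le_trans _ ler01)// oppr_le0.
have bias_p : `|gp - f (theta0 + u)| <= r.
  apply: (bias_le (PT _) mT r0); apply: risk.
  by have := ball 1 lt11 (lexx _); rewrite scale1r.
have bias_m : `|gm - f (theta0 - u)| <= r.
  apply: (bias_le (PT _) mT r0); apply: risk.
  by have := ball (-1) (lexx _) lt11; rewrite scaleN1r.
have incr : 2 * (delta / enorm h * s0 ^+ 2 - B * delta) <=
    f (theta0 + u) - f (theta0 - u).
  have := line_increment_ge f_holder (x := theta0) (u := u) (B := B)
    (fun t t0 t1 => grad_le _ (ball t t0 t1)).
  by rewrite eu dotpC dotpZl hg.
(* The displacement of the mean costs [2 r (k + 1)], and the biases at the two endpoints cost [r]
   each. *)
have main : delta / enorm h * s0 ^+ 2 - B * delta <= r * (k + 2).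
  move: disp bias_p bias_m => /ler_normlP[_ d1] /ler_normlP[d2 _] /ler_normlP[_ d3].
  by lra.
apply: (bias_variance_algebra s_ge0 b0 k0).
  (* From [sqrt 8 <= 3] and [c mu <= k] follows [x k >= pi >= 2]; this is where the constant
     [3 pi / sqrt 8] enters. *)
  have s8 : Num.sqrt (8 * m) <= 3 * mu.
    rewrite -(@ler_pXn2r _ 2)// ?nnegrE ?sqrtr_ge0 ?mulr_ge0 ?(ltW mu0)//.
    rewrite exprMn !sqr_sqrtr ?mulr_ge0 ?(ltW m_gt0)//; lra.
  have s8p : 0 < Num.sqrt (8 * m) by rewrite sqrtr_gt0 mulr_gt0.
  rewrite /x mulrAC ler_pdivlMr ?mulr_gt0//.
  apply: (@le_trans _ _ (2 * (3 * k))).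
    rewrite ler_wpM2l// (le_trans (_ : _ <= 3 * mu * c)) ?ler_wpM2r ?(ltW c0)//.
    by rewrite -mulrA ler_wpM2l// mulrC.
  by have := pi_ge2 R; nra.
(* Scaling by [sn / s0] makes [main] dimensionless: [k - b c mu <= s (1 + b) (k + 2)], and
   [c mu <= k] bounds the left-hand side below by [k (1 - b)]. *)
have : (delta / enorm h * s0 ^+ 2 - B * delta) * (sn / s0) <=
    r * (k + 2) * (sn / s0).
  by rewrite ler_wpM2r// divr_ge0 ?ltW.
have -> : (delta / enorm h * s0 ^+ 2 - B * delta) * (sn / s0) = k - b * (c * mu).
  by rewrite /k /b /delta; field; rewrite snz !gt_eqF.
have -> : r * (k + 2) * (sn / s0) = s * (1 + b) * (k + 2).
  by rewrite /r; field; rewrite snz gt_eqF.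
have := ler_wpM2l b0 kmu; lra.
Qed.
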